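(* $\displaystyle \mathrm{m}_\mathbb{D}(1+x+y)=\frac{3\sqrt{3}}{4\pi}L(\chi_{-3},2)+\frac{1}{6}- \frac{11\sqrt{3}}{16\pi}.$
   Context: For a nonzero rational function $P\in\mathbb{C}(x_1,\dots,x_n)$, the (logarithmic) areal Mahler measure is $\mathrm{m}_\mathbb{D}(P)=\frac{1}{\pi^n}\int_{\mathbb{D}^n}\log|P(x_1,\dots,x_n)|\,dA(x_1)\cdots dA(x_n)$, where $\mathbb{D}=\{x\in\mathbb{C}:|x|\le 1\}$ is the closed unit disk and $dA$ is Lebesgue (area) measure on $\mathbb{C}$. $L(\chi_{-3},s)$ is the Dirichlet $L$-function of the character $\chi_{-3}=\left(\frac{-3}{\cdot}\right)$ of conductor 3. *)

(* Defs.v *)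
From HB Require Import structures.
From mathcomp Require Import all_boot all_order all_algebra.
From mathcomp Require Import all_classical all_reals all_analysis.
Unset Printing Implicit Defensive.
Import Order.TTheory GRing.Theory Num.Theory.
Import numFieldNormedType.Exports.
Local Open Scope classical_set_scope.
Local Open Scope ring_scope.

Definition chi_m3 (R : realType) (n : nat) : R :=
  if (n %% 3 == 1)%N then 1 else if (n %% 3 == 2)%N then -1 else 0.

Definition L_chi_m3_2 (R : realType) : R :=
  limn (fun N : nat => \sum_(1 <= n < N) (chi_m3 R n / (n%:R ^+ 2))).

(* A point of C^2 = (x, y) is encoded as ((Re x, Im x), (Re y, Im y)) in
   (R * R) * (R * R); Lebesgue measure on C = R^2 is the product of the
   Lebesgue measures on R, and the measure on C^2 is dA(x) dA(y). *)
Definition lebC (R : realType) :=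
  product_measure1 (@lebesgue_measure R) (@lebesgue_measure R).
Definition lebC2 (R : realType) := product_measure1 (@lebC R) (@lebC R).

Definition diskC (R : realType) : set (R * R) :=
  [set z | z.1 ^+ 2 + z.2 ^+ 2 <= 1].

Definition bidisk (R : realType) : set ((R * R) * (R * R)) :=
  [set p | diskC R p.1 /\ diskC R p.2].

Definition log_abs_1xy (R : realType) (p : (R * R) * (R * R)) : R :=
  ln (Num.sqrt ((1 + p.1.1 + p.2.1) ^+ 2 + (p.1.2 + p.2.2) ^+ 2)).

(* Main.v *)
Require Import Defs.
From HB Require Import structures.
From mathcomp Require Import all_boot all_order all_algebra.
From mathcomp Require Import all_classical all_reals all_analysis.
From mathcomp Require Import measurable_realfun ring lra.
Import Order.TTheory GRing.Theory Num.Theory.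
Import numFieldNormedType.Exports.
Local Open Scope classical_set_scope.
Local Open Scope ring_scope.

(* Jensen's formula, integrated over circles, shows that the integral of
   ln |a + y| over the disk |y| <= 1 is pi ln |a| when |a| >= 1 and
   pi (|a|^2 - 1) / 2 when |a| <= 1. With a = 1 + x, the disk |a - 1| <= 1 is
   r <= 2 cos t in the polar coordinates of a, so that integrating in r leaves
   a single integral in t. Its part |t| >= pi / 3 is a trigonometric polynomial;
   its part |t| <= pi / 3 reduces to the integral of ln (2 cos t), whose Fourier
   series integrates to (3 sqrt 3 / 4) L(chi_-3, 2).
   All integrands are first replaced by c - ln |..| >= 0 with c >= ln 3, so that
   Tonelli's theorem applies without knowing integrability beforehand; comparing
   the results for c = ln 3 and c = ln 3 + 1 then gives the area of the bidisk. *)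

(** Polar coordinates are built from Tonelli and one-dimensional scaling alone: each vertical line
    is rescaled to the slope [m = y / x], and the substitution [m = tan t] restores the angle. The
    price is a signed radius, [r] and [-r] giving antipodal points. Jensen's formula turns this into
    an advantage: the identity [|w + s e^(it)| |w - s e^(it)| = |w^2 - s^2 e^(2it)|] that merges
    antipodal points also drives its proof, which needs no complex analysis. The angle [pi / 3] is
    where the curve [r = 2 cos t] crosses the unit circle. It matters three times: the disk mean
    changes formula at [|a| = 1]; for [|t| <= pi / 3] the point [e^(2it)] stays away from [-1], so
    the logarithmic series has a uniform error [O(1 / N)] and can be integrated term by term; and
    [sin (2 n pi / 3)] is [sqrt 3 / 2] times the character. The Fourier series alternates, which
    turns [L] into [3 / 2 L] because the character is [-1] at 2; hence the factor [3 sqrt 3 / 4]. *)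

(** * Affine change of variables for Lebesgue measure on the line *)

Section affine.
Context {R : realType}.
Local Notation mu := (@lebesgue_measure R).
Local Open Scope ereal_scope.

Let affine (k d : R) (x : measurableTypeR R) : measurableTypeR R := (k * x + d)%R.

Let measurable_affine (k d : R) : measurable_fun setT (affine k d).
Proof.
have : measurable_fun setT (fun x : R => k * x + d)%R by
  apply: measurable_funD => //; exact: measurable_funM.
exact.
Qed.

(** Lebesgue measure is determined by its values on half-open intervals, where the scaled
    pushforward is explicit; for [k < 0] the preimage is half-open on the other side. *)
Lemma lebesgue_measure_affine (k d : R) (A : set R) : k != 0%R -> measurable A ->
  mu A = `|k|%:E * mu ((fun x => k * x + d)%R @^-1` A).
Proof.
move=> k0 mA.
have mphi := measurable_affine k d.
(* Named explicitly: unification cannot find the measurability proof that the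
   measure structure of a pushforward depends on. *)
pose nu : {measure set (measurableTypeR R) -> \bar R} :=
  measure_function_pushforward__canonical__measure_function_Measure mu mphi.
suff : mu A = mscale (NngNum (normr_ge0 k)) nu A by [].
apply: lebesgue_measure_unique => //= _ [[a b]] _ <-.
rewrite /mscale/= /pushforward.
have [kp|kn] := ltP 0%R k.
  have -> : (fun x : R => k * x + d)%R @^-1` [set` `]a, b]%R] =
    [set` `](a - d) / k, (b - d) / k]%R].
    apply/seteqP; split => x /=; rewrite !in_itv/= ltr_pdivrMr// ler_pdivlMr//
      ltrBlDr lerBrDr mulrC //.
  rewrite !lebesgue_measure_itv/= !lte_fin gtr0_norm// ltr_pM2r ?invr_gt0// ltrD2r.
  case: ifP => _; last by rewrite mule0.
  by rewrite -!EFinB -EFinM; congr EFin; field.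
have {}kn : (k < 0)%R by rewrite lt_neqAle k0.
have -> : (fun x : R => k * x + d)%R @^-1` [set` `]a, b]%R] =
  [set` `[(b - d) / k, (a - d) / k[%R].
  apply/seteqP; split => x /=; rewrite !in_itv/= ltr_ndivlMr// ler_ndivrMr//
    ltrBlDr lerBrDr (mulrC x) andbC //.
rewrite !lebesgue_measure_itv/= !lte_fin ltr0_norm// ltr_nM2r ?invr_lt0// ltrD2r.
case: ifP => _; last by rewrite mule0.
by rewrite -!EFinB -EFinM; congr EFin; field.
Qed.

Lemma ge0_integral_affine (k d : R) (f : R -> \bar R) : k != 0%R ->
  measurable_fun setT f -> (forall x, 0 <= f x) ->
  \int[mu]_x f x = `|k|%:E * \int[mu]_x f (k * x + d)%R.
Proof.
move=> k0 mf f0.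
have mphi := measurable_affine k d.
pose nu : {measure set (measurableTypeR R) -> \bar R} :=
  measure_function_pushforward__canonical__measure_function_Measure mu mphi.
have := ge0_integral_pushforward mphi mu measurableT mf (fun y _ => f0 y).
rewrite preimage_setT => <-.
rewrite -[X in _ = _ * X]/(\int[nu]_x f x).
rewrite -(ge0_integral_mscale _ measurableT (NngNum (normr_ge0 k)))//.
by apply: eq_measure_integral => A mA _; exact: lebesgue_measure_affine.
Qed.

Lemma measurable_fun_affine (k d : R) (f : R -> \bar R) :
  measurable_fun setT f -> measurable_fun setT (fun x => f (k * x + d)%R).
Proof.
move=> mf; apply: measurableT_comp => //.
by apply: measurable_funD => //; exact: measurable_funM.
Qed.

End affine.

(** * Polar coordinates by slope and signed radius *)

Section slope_polar.
Context {R : realType}.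
Local Notation mu := (@lebesgue_measure R).
Local Open Scope ereal_scope.

Lemma sqrt1Dsqr_gt0 (m : R) : (0 < Num.sqrt (1 + m ^+ 2))%R.
Proof. by rewrite sqrtr_gt0 ltr_pwDl ?sqr_ge0. Qed.

(* [sqrt1V m] is the cosine of the angle of slope [m]. *)
Definition sqrt1V (m : R) : R := (Num.sqrt (1 + m ^+ 2))^-1.

Lemma sqrt1V_gt0 m : (0 < sqrt1V m)%R.
Proof. by rewrite invr_gt0 sqrt1Dsqr_gt0. Qed.

Lemma measurable_sqrt1V : measurable_fun setT sqrt1V.
Proof.
apply: continuous_measurable_fun => m.
apply: cvgV; first by rewrite gt_eqF// sqrt1Dsqr_gt0.
apply: (@continuous_comp R R R (fun m => 1 + m ^+ 2)%R Num.sqrt m).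
  by apply: cvgD; [exact: cvg_cst|exact: exprn_continuous].
exact: sqrt_continuous.
Qed.

(* Polar coordinates with a signed radius [r] and the slope [m] in place of the
   angle: the area element is [|r| dr dm / (1 + m ^ 2)]. *)
Definition polar_integrand (f : R * R -> \bar R) (m r : R) : \bar R :=
  f (r * sqrt1V m, r * (m * sqrt1V m))%R * (`|r| * sqrt1V m ^+ 2)%:E.

Lemma measurable_polar_integrand f : measurable_fun setT f ->
  measurable_fun setT (fun p : R * R => polar_integrand f p.1 p.2).
Proof.
move=> mf; apply: emeasurable_funM.
  apply: measurableT_comp => //; apply: measurable_fun_pair => /=.
    apply: measurable_funM => //; exact: measurableT_comp measurable_sqrt1V _.
  apply: measurable_funM => //; apply: measurable_funM => //;
    exact: measurableT_comp measurable_sqrt1V _.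
apply/measurable_EFinP; apply: measurable_funM; first exact: measurableT_comp.
apply: measurable_funX; exact: measurableT_comp measurable_sqrt1V _.
Qed.

(** For fixed [x], the scaling [y = x m] has Jacobian [|x|]; after exchanging the integrals, for
    fixed [m], the scaling [x = r * sqrt1V m] makes [r] the signed distance to the origin. *)
Lemma ge0_integral_slope_polar (f : R * R -> \bar R) :
  measurable_fun setT f -> (forall p, 0 <= f p) ->
  \int[mu \x mu]_p f p = \int[mu]_m \int[mu]_r polar_integrand f m r.
Proof.
move=> mf f0; rewrite fubini_tonelli1//.
have mg : measurable_fun setT (fun p : R * R => f (p.1, p.1 * p.2)%R * `|p.1|%:E).
  apply: emeasurable_funM; last by apply/measurable_EFinP; exact: measurableT_comp.
  apply: measurableT_comp => //; apply: measurable_fun_pair => //=.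
  exact: measurable_funM.
have g0 (p : R * R) : 0 <= f (p.1, p.1 * p.2)%R * `|p.1|%:E by rewrite mule_ge0// lee_fin.
transitivity (\int[mu]_x \int[mu]_m (f (x, x * m)%R * `|x|%:E)).
  (* The scaling degenerates at [x = 0], a null set removed from both sides. *)
  rewrite -(@integral_setD1 _ _ 0%R setT) ?setTI//; last 2 first.
    by apply: measurableD.
    by apply: measurable_funTS; exact: (@measurable_fun_fubini_tonelli_F _ _ _ _ _ mu _ mf f0).
  rewrite -[RHS](@integral_setD1 _ _ 0%R setT) ?setTI//; last 2 first.
    by apply: measurableD.
    by apply: measurable_funTS; exact: (@measurable_fun_fubini_tonelli_F _ _ _ _ _ mu _ mg g0).
  apply: eq_integral => x; rewrite inE/= => -[_ /eqP x0].
  rewrite /fubini_F (@ge0_integral_affine _ x 0%R)//; last exact: (measurable_fun_pair2 x mf).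
  rewrite ge0_integralZr//; first by rewrite muleC; congr (_ * _); apply: eq_integral => m _;
    rewrite addr0.
  under eq_fun do rewrite -[(x * _)%R]addr0.
  exact: measurable_fun_affine (measurable_fun_pair2 x mf).
transitivity (\int[mu]_m \int[mu]_x (f (x, x * m)%R * `|x|%:E)).
  exact: (@fubini_tonelli _ _ _ _ _ mu mu _ mg g0).
apply: eq_integral => m _; rewrite /fubini_G/=.
rewrite (@ge0_integral_affine _ (sqrt1V m) 0%R _ _ (measurable_fun_pair1 m mg) (fun x =>
  g0 (x, m)))
  ?gt_eqF ?sqrt1V_gt0//=.
rewrite -ge0_integralZl//=; last 2 first.
 - exact: measurable_fun_affine (measurable_fun_pair1 m mg).
 - by move=> x _; exact: (g0 (_, m)).
  apply: eq_integral => r _; rewrite addr0 /polar_integrand normrM !(gtr0_norm (sqrt1V_gt0 m)).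
  rewrite muleC -muleA -EFinM; congr (f _ * _%:E).
    by congr pair; ring.
  by ring.
Qed.

End slope_polar.

(** * One-dimensional integration: primitives and substitutions *)

Section calculus.
Context {R : realType}.
Local Notation mu := (@lebesgue_measure R).

Lemma FTC2_is_derive (f F : R -> R) (a b : R) : a <= b ->
  (forall x, a <= x <= b -> {for x, continuous f}) ->
  (forall x, a <= x <= b -> is_derive x 1 F (f x)) ->
  (\int[mu]_(x in `[a, b]) (f x)%:E = (F b - F a)%:E)%E.
Proof.
rewrite le_eqVlt => /predU1P[<- _ _|ab cf dF].
  by rewrite set_itv1 integral_set1 subrr.
have cF x : a <= x <= b -> {for x, continuous F}.
  by move=> /dF ?; apply: differentiable_continuous; exact/derivable1_diffP.
rewrite (@continuous_FTC2 _ f F)//.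
- by apply: continuous_in_subspaceT => x; rewrite inE/= in_itv/= => /cf.
- split.
  + by move=> x; rewrite in_itv/= => /andP[/ltW ax /ltW xb];
    have [] : is_derive x 1 F (f x) by apply: dF; rewrite ax.
  + by apply: cvg_at_right_filter; apply: cF; rewrite lexx ltW.
  + by apply: cvg_at_left_filter; apply: cF; rewrite lexx ltW.
- move=> x; rewrite in_itv/= => /andP[/ltW ax /ltW xb].
  have xab : a <= x <= b by rewrite ax.
  by have := dF _ xab => ?; rewrite derive1E derive_val.
Qed.

Lemma integral_itv_affine (k d a b : R) (f : R -> R) : 0 < k -> a <= b ->
  {within `[k * a + d, k * b + d], continuous f} ->
  (\int[mu]_(x in `[(k * a + d)%R, (k * b + d)%R]) (f x)%:E =
   \int[mu]_(x in `[a, b]) (k * f (k * x + d)%R)%:E)%E.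
Proof.
move=> k0 ab cf.
pose F x := k * x + d.
have dF (x : R) : is_derive x 1 F k.
  apply: is_derive_eq; rewrite /GRing.scale /=; ring.
have F' : derive1 F = cst k by apply/funext => x; rewrite derive1E derive_val.
have cF : continuous F.
  by move=> x; apply: differentiable_continuous; exact/derivable1_diffP.
rewrite (@integration_by_substitution_increasing _ F)//.
- by apply: eq_integral => x _ /=; rewrite F' /= mulrC.
- by move=> x y _ _ xy; rewrite /F ltrD2r ltr_pM2l.
- by rewrite F' => x _; exact: cvg_cst.
- by rewrite F'; exact: is_cvg_cst.
- by rewrite F'; exact: is_cvg_cst.
- split.
  + by move=> x _; have [] := dF x.
  + by apply: cvg_at_right_filter; exact: cF.
  + by apply: cvg_at_left_filter; exact: cF.
Qed.

(** Substitution by [atan] is available on each compact [[-n, n]]; these exhaust the line and their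
    images the open interval, so monotone convergence applies to both sides. *)
Lemma ge0_integral_tan (G : R -> R) : continuous G -> (forall x, 0 <= G x) ->
  (\int[mu]_m (G m / (1 + m ^+ 2))%:E =
   \int[mu]_(t in `](-(pi / 2))%R, (pi / 2)%R[) (G (tan t))%:E)%E.
Proof.
move=> cG G0.
have mG : measurable_fun setT G by exact: continuous_measurable_fun.
have mG' : measurable_fun setT (fun m => G m / (1 + m ^+ 2)).
  apply: continuous_measurable_fun => x; apply: cvgM; first exact: cG.
  exact: continuous_oneDsqrV.
have mtan : measurable_fun `](-(pi / 2))%R, (pi / 2)%R[ (fun t : R => (G (tan t))%:E).
  apply/measurable_EFinP; apply: measurableT_comp => //.
  apply: open_continuous_measurable_fun; first exact: interval_open.
  move=> x; rewrite inE/= in_itv/= => /cos_gt0_pihalf cx.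
  by apply: continuous_tan; rewrite gt_eqF.
have atanS n : `[atan (- n%:R), atan n%:R] `<=` `]-(pi / 2), (pi / 2 : R)[.
  move=> x /=; rewrite !in_itv/= => /andP[nx xn].
  by rewrite (lt_le_trans _ nx) ?atan_gtNpi2// (le_lt_trans xn) ?atan_ltpi2.
have step n : (\int[mu]_(m in `[(- n%:R)%R, (n%:R)%R]) (G m / (1 + m ^+ 2))%:E =
    \int[mu]_(t in `[atan (- n%:R)%R, atan (n%:R)%R]) (G (tan t))%:E)%E.
  have n0 : (- n%:R : R) <= n%:R by apply: (@le_trans _ _ 0); rewrite ?oppr_le0.
  rewrite (@integration_by_substitution_increasing _ atan (G \o tan))//.
  - by apply: eq_integral => x _; rewrite /= fctE/= atanK derive1_atan.
  - by move=> x y _ _; exact: lt_atan.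
  - by rewrite (funext (@derive1_atan R)) => x _; exact: continuous_oneDsqrV.
  - rewrite (funext (@derive1_atan R)); apply: (cvgP _ (cvg_at_right_filter _)).
    exact: continuous_oneDsqrV.
  - rewrite (funext (@derive1_atan R)); apply: (cvgP _ (cvg_at_left_filter _)).
    exact: continuous_oneDsqrV.
  - split.
    + by move=> x _; exact: derivable_atan.
    + by apply: cvg_at_right_filter; exact: continuous_atan.
    + by apply: cvg_at_left_filter; exact: continuous_atan.
  - apply: continuous_in_subspaceT => x; rewrite inE => /atanS/=;
    rewrite in_itv/= => /cos_gt0_pihalf cx.
    by apply: continuous_comp; [apply: continuous_tan; rewrite gt_eqF|exact: cG].
have cover1 : \bigcup_n `[- n%:R, n%:R]%classic = [set: R] by exact: bigcup_itvT.
have cover2 : \bigcup_n `[atan (- n%:R), atan n%:R]%classic =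
  `]-(pi / 2), (pi / 2 : R)[%classic.
  apply/seteqP; split => [x [n _] /atanS//|x xpi].
  have : [set: R] (tan x) by [].
  rewrite -cover1 => -[n _]/=; rewrite in_itv/= => /andP[nx xn].
  exists n => //=; rewrite in_itv/=.
  by rewrite -(@tanK _ x)// !le_atan.
have lim1 := @ge0_nondecreasing_set_cvg_integral _ (measurableTypeR R) R (fun n =>
  [set` `[- n%:R, (n%:R : R)]]) (fun m => (G m / (1 + m ^+ 2))%:E) mu.
have lim2 := @ge0_nondecreasing_set_cvg_integral _ (measurableTypeR R) R (fun n =>
  [set` `[atan (- n%:R), (atan n%:R : R)]]) (fun t => (G (tan t))%:E) mu.
rewrite cover1 in lim1; rewrite cover2 in lim2.
rewrite (funext step) in lim1.
apply: cvg_unique (lim1 _ _ _ _) (lim2 _ _ _ _) => //.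
- apply/nondecreasing_seqP => n; apply/subsetPset => x/=; rewrite !in_itv/= => /andP[nx xn].
  by rewrite (le_trans _ nx) ?lerN2 ?ler_nat// (le_trans xn)// ler_nat.
- by move=> n; apply/measurable_EFinP; exact: measurable_funTS.
- by move=> n x _; rewrite lee_fin divr_ge0// addr_ge0// sqr_ge0.
- apply/nondecreasing_seqP => n; apply/subsetPset => x/=; rewrite !in_itv/= => /andP[nx xn].
  by rewrite (le_trans _ nx) ?le_atan ?lerN2 ?ler_nat// (le_trans xn)// le_atan// ler_nat.
- by move=> n; apply: measurable_funS mtan.
- by move=> n x _; rewrite lee_fin.
Qed.

End calculus.

(** * Jensen's formula for a linear polynomial on a circle *)

Section jensen.
Context {R : realType}.
Local Notation mu := (@lebesgue_measure R).

Lemma continuous_integrable_itv (f : R -> R) (a b : R) : continuous f ->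
  mu.-integrable `[a, b] (EFin \o f).
Proof.
move=> cf; apply: continuous_compact_integrable; first exact: segment_compact.
exact: continuous_subspaceT.
Qed.


Lemma Rintegral_itv_split (f : R -> R) (a c b : R) : a <= c -> c <= b ->
  mu.-integrable `[a, b] (EFin \o f) ->
  \int[mu]_(x in `[a, b]) f x =
  \int[mu]_(x in `[a, c]) f x + \int[mu]_(x in `[c, b]) f x.
Proof.
move=> ac cb fi.
have := @Rintegral_itvB R f (BLeft a) (BRight b) c fi; rewrite !bnd_simp => /(_ ac cb).
rewrite Rintegral_itv_obnd_cbnd; first by move=> <-; rewrite addrC subrK.
apply: (integrableS _ _ _ fi) => //.
by move=> x /=; rewrite !in_itv/= => /andP[/ltW cx ->]; rewrite (le_trans ac cx).
Qed.

(* [|w + s e^(it)|^2] for the complex number [w = w1 + i w2]. *)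
Definition circle_dist2 (w1 w2 s t : R) : R :=
  (w1 + s * cos t) ^+ 2 + (w2 + s * sin t) ^+ 2.

(** Squared modulus of [(w + s e^(it)) (w - s e^(it)) = w^2 - s^2 e^(2it)]. *)
Lemma circle_dist2_mul (w1 w2 s t : R) :
  circle_dist2 w1 w2 s t * circle_dist2 w1 w2 s (t + pi) =
  circle_dist2 (w1 ^+ 2 - w2 ^+ 2) (2 * w1 * w2) (- s ^+ 2) (2 * t).
Proof.
rewrite /circle_dist2 cosDpi sinDpi.
have -> : 2 * t = t + t by ring.
by rewrite cosD sinD; ring.
Qed.

(** Parallelogram law: the missing term is [|w - s e^(it)|^2]. *)
Lemma circle_dist2_le (w1 w2 s t : R) :
  circle_dist2 w1 w2 s t <= 2 * (w1 ^+ 2 + w2 ^+ 2 + s ^+ 2).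
Proof.
rewrite -subr_ge0 /circle_dist2.
have -> : s ^+ 2 = s ^+ 2 * (cos t ^+ 2 + sin t ^+ 2) by rewrite cos2Dsin2 mulr1.
rewrite [leRHS](_ : _ = (w1 - s * cos t) ^+ 2 + (w2 - s * sin t) ^+ 2); last by ring.
by rewrite addr_ge0// sqr_ge0.
Qed.

(** A root-free form of [||w| - |s|| <= |w + s e^(it)|], using
    [(|w| + |s|)^2 <= 2 (|w|^2 + s^2)]. *)
Lemma circle_dist2_ge (w1 w2 s t : R) :
  (w1 ^+ 2 + w2 ^+ 2 - s ^+ 2) ^+ 2 <=
  2 * (w1 ^+ 2 + w2 ^+ 2 + s ^+ 2) * circle_dist2 w1 w2 s t.
Proof.
rewrite -subr_ge0.
have e : sin t ^+ 2 = 1 - cos t ^+ 2 by rewrite sin2cos2.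
rewrite [leRHS](_ : _ = circle_dist2 w1 w2 s t ^+ 2 +
  4 * s ^+ 2 * (w1 * sin t - w2 * cos t) ^+ 2).
  by rewrite addr_ge0 ?sqr_ge0// mulr_ge0 ?sqr_ge0// mulr_ge0 ?sqr_ge0.
rewrite /circle_dist2; ring: e.
Qed.

Lemma circle_dist2_gt0 (w1 w2 s t : R) : w1 ^+ 2 + w2 ^+ 2 != s ^+ 2 ->
  0 < circle_dist2 w1 w2 s t.
Proof.
rewrite -subr_eq0 => ne.
rewrite lt_neqAle addr_ge0 ?sqr_ge0// andbT eq_sym.
apply/negP => /eqP e0; move: (circle_dist2_ge w1 w2 s t).
by rewrite e0 mulr0 leNgt exprn_even_gt0// ne.
Qed.

Lemma continuous_circle_dist2 (w1 w2 s : R) : continuous (circle_dist2 w1 w2 s).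
Proof.
move=> t; apply: differentiable_continuous; apply/derivable1_diffP.
rewrite /circle_dist2; exact: ex_derive.
Qed.

Lemma continuous_ln_circle_dist2 (w1 w2 s : R) : w1 ^+ 2 + w2 ^+ 2 != s ^+ 2 ->
  continuous (@ln R \o circle_dist2 w1 w2 s).
Proof.
move=> ne t; apply: continuous_comp; first exact: continuous_circle_dist2.
by apply: continuous_ln; exact: circle_dist2_gt0.
Qed.

Definition circle_mean (w1 w2 s : R) : R :=
  \int[mu]_(t in `[0, 2 * pi]) ln (circle_dist2 w1 w2 s t).

Lemma norm_sq_sq (w1 w2 : R) :
  (w1 ^+ 2 - w2 ^+ 2) ^+ 2 + (2 * w1 * w2) ^+ 2 = (w1 ^+ 2 + w2 ^+ 2) ^+ 2.
Proof. by ring. Qed.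

(** Pair [t] with [t + pi], multiply the two distances, and substitute the double angle. *)
Lemma circle_mean_half (w1 w2 s : R) : w1 ^+ 2 + w2 ^+ 2 != s ^+ 2 ->
  circle_mean w1 w2 s =
  circle_mean (w1 ^+ 2 - w2 ^+ 2) (2 * w1 * w2) (- s ^+ 2) / 2.
Proof.
move=> ne; have ch := continuous_ln_circle_dist2 _ _ _ ne.
have ne2 : (w1 ^+ 2 - w2 ^+ 2) ^+ 2 + (2 * w1 * w2) ^+ 2 != (- s ^+ 2) ^+ 2.
  by rewrite norm_sq_sq sqrrN eqrXn2 ?addr_ge0 ?sqr_ge0.
have cg := continuous_ln_circle_dist2 _ _ _ ne2.
set h := @ln R \o _ in ch; set g := @ln R \o _ in cg.
have p0 := pi_gt0 R.
have hp : continuous (fun t => h (t + pi)).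
  by move=> t; apply: (@continuous_comp R R R (fun t => t + pi) h); [apply: cvgD;
    [exact: cvg_id|exact: cvg_cst]|exact: ch].
have -> : circle_mean w1 w2 s = \int[mu]_(t in `[0, pi]) h t + \int[mu]_(t in `[pi, 2 *
  pi]) h t.
  by apply: Rintegral_itv_split; [lra|lra|exact: continuous_integrable_itv].
have -> : \int[mu]_(t in `[pi, 2 * pi]) h t = \int[mu]_(t in `[0, pi]) h (t + pi).
  rewrite /Rintegral; congr fine.
  have := @integral_itv_affine R 1 pi 0 pi h ltr01 (ltW p0).
  rewrite mulr0 add0r mul1r (_ : pi + pi = 2 * pi); last by ring.
  move=> ->; last exact: continuous_subspaceT.
  by apply: eq_integral => x _; rewrite !mul1r.
have -> : circle_mean (w1 ^+ 2 - w2 ^+ 2) (2 * w1 * w2) (- s ^+ 2) =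
  2 * \int[mu]_(t in `[0, pi]) g (2 * t).
  rewrite -RintegralZl//; last first.
    apply: (@continuous_integrable_itv (fun t => g (2 * t))) => t.
    by apply: (@continuous_comp R R R (fun t => 2 * t) g); [apply: cvgM;
      [exact: cvg_cst|exact: cvg_id]|exact: cg].
  rewrite /circle_mean /Rintegral; congr fine.
  have := @integral_itv_affine R 2 0 0 pi g (ltr0Sn _ _) (ltW p0).
  rewrite mulr0 !addr0 => ->; last exact: continuous_subspaceT.
  by apply: eq_integral => x _; rewrite addr0.
rewrite mulrAC divff// mul1r -RintegralD//; [|exact: continuous_integrable_itv..].
apply: eq_Rintegral => t _; rewrite /h /g /= -lnM ?posrE ?circle_dist2_gt0//.
by rewrite circle_dist2_mul.
Qed.

(** Here [q < 1] bounds the ratio of the smaller to the larger of [|w|^2] and [s^2]. The squared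
    distance then lies between [m (1 - q)^2 / 4] and [4 m], and the lower end is the worse one. The
    bound depends on [q] alone, so it can be reused along the iteration. *)
Lemma ln_circle_dist2_bound (q w1 w2 s t : R) : 0 <= q < 1 ->
  let W := w1 ^+ 2 + w2 ^+ 2 in let m := Num.max W (s ^+ 2) in
  0 < m -> Num.min W (s ^+ 2) <= q * m ->
  `|ln (circle_dist2 w1 w2 s t) - ln m| <= - ln ((1 - q) ^+ 2 / 4).
Proof.
move=> /andP[q0 q1] W m m0 Hq.
have W0 : 0 <= W by rewrite addr_ge0// sqr_ge0.
have S0 : 0 <= s ^+ 2 by rewrite sqr_ge0.
have up := circle_dist2_le w1 w2 s t; have lo := circle_dist2_ge w1 w2 s t.
rewrite -/W in up lo; set D := circle_dist2 _ _ _ _ in up lo *.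
have Tm : W + s ^+ 2 <= 2 * m by rewrite /m; case: (leP W (s ^+ 2)) => ?; lra.
have Dm : m ^+ 2 * (1 - q) ^+ 2 <= (W - s ^+ 2) ^+ 2.
  rewrite -exprMn; have : 0 <= m * (1 - q) by apply: mulr_ge0; [exact: ltW|lra].
  rewrite /m in Hq *; case: (leP W (s ^+ 2)) Hq => Ws Hq h.
    by rewrite -[leRHS]sqrrN ler_pXn2r ?nnegrE//; lra.
  by rewrite ler_pXn2r ?nnegrE//; lra.
have D1 : D <= 4 * m by lra.
have D0 : 0 <= D by rewrite addr_ge0// sqr_ge0.
have D2 : m * ((1 - q) ^+ 2 / 4) <= D.
  have : m ^+ 2 * (1 - q) ^+ 2 <= 4 * m * D.
    apply: (le_trans Dm); apply: (le_trans lo).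
    by rewrite ler_wpM2r//; lra.
  rewrite expr2 -mulrA [leRHS](_ : _ = m * (4 * D)); last by ring.
  by rewrite ler_pM2l//; lra.
have Q0 : 0 < (1 - q) ^+ 2 / 4 by rewrite divr_gt0// exprn_gt0// subr_gt0.
have Dp : 0 < D by rewrite (lt_le_trans _ D2)// mulr_gt0.
have lnD1 : ln D <= ln 4 + ln m by rewrite -lnM ?posrE// ler_ln ?posrE// mulr_gt0.
have lnD2 : ln m + ln ((1 - q) ^+ 2 / 4) <= ln D by rewrite -lnM ?posrE// ler_ln ?posrE//
  mulr_gt0.
have ln4 : ln 4 <= - ln ((1 - q) ^+ 2 / 4) :> R.
  rewrite -lnV ?posrE// ler_ln ?posrE ?invr_gt0// invf_div ler_pdivlMr ?exprn_gt0 ?subr_gt0//.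
  have : (1 - q) ^+ 2 <= 1 by rewrite expr_le1//; lra.
  lra.
by rewrite ler_norml; apply/andP; split; lra.
Qed.

Lemma circle_mean_bound (q w1 w2 s : R) : 0 <= q < 1 ->
  let W := w1 ^+ 2 + w2 ^+ 2 in let m := Num.max W (s ^+ 2) in
  0 < m -> Num.min W (s ^+ 2) <= q * m ->
  `|circle_mean w1 w2 s - 2 * pi * ln m| <= 2 * pi * - ln ((1 - q) ^+ 2 / 4).
Proof.
move=> q01 W m m0 Hq; have /andP[q0 q1] := q01.
have ne : W != s ^+ 2.
  apply/negP => /eqP e; move: Hq m0; rewrite /m e maxxx minxx => Hq m0.
  have : q * s ^+ 2 < s ^+ 2 by rewrite gtr_pMl.
  by rewrite ltNge Hq.
have p0 := pi_gt0 R.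
have intc r : \int[mu]_(t in `[0, 2 * pi]) (cst r t) = 2 * pi * r.
  rewrite Rintegral_cst//= lebesgue_measure_itv/= lte_fin ifT; last by lra.
  by rewrite -EFinB/= subr0 mulrC.
have ib := fun t => ln_circle_dist2_bound _ _ _ _ t q01 m0 Hq.
set B := - ln ((1 - q) ^+ 2 / 4) in ib *.
have ci := continuous_integrable_itv _ 0 (2 * pi) (continuous_ln_circle_dist2 _ _ _ ne).
have cc r : mu.-integrable `[0, 2 * pi] (EFin \o cst r).
  by apply: continuous_integrable_itv => t; exact: cvg_cst.
rewrite ler_norml; apply/andP; split.
  rewrite lerBrDr -mulrN -mulrDr -intc; apply: le_Rintegral => //= t _.
  by have := ib t; rewrite ler_norml => /andP[]; lra.
rewrite lerBlDr -mulrDr -intc; apply: le_Rintegral => //= t _.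
by have := ib t; rewrite ler_norml => /andP[]; lra.
Qed.

(** Squaring doubles both the mean and [ln m], so each round halves the error. The ratio becomes at
    most [q^2 <= q], hence the same [q] serves in every round. *)
Lemma circle_mean_bound_exp (q : R) (n : nat) (w1 w2 s : R) : 0 <= q < 1 ->
  let W := w1 ^+ 2 + w2 ^+ 2 in let m := Num.max W (s ^+ 2) in
  0 < m -> Num.min W (s ^+ 2) <= q * m ->
  `|circle_mean w1 w2 s - 2 * pi * ln m| <=
  2 * pi * - ln ((1 - q) ^+ 2 / 4) / 2 ^+ n.
Proof.
move=> q01; have /andP[q0 q1] := q01.
elim: n w1 w2 s => [|n IH] w1 w2 s W m m0 Hq.
  by rewrite expr0 divr1; exact: circle_mean_bound.
have ne : W != s ^+ 2.
  apply/negP => /eqP e; move: Hq m0; rewrite /m e maxxx minxx => Hq m0.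
  have : q * s ^+ 2 < s ^+ 2 by rewrite gtr_pMl.
  by rewrite ltNge Hq.
have W0 : 0 <= W by rewrite addr_ge0// sqr_ge0.
have S0 : 0 <= s ^+ 2 by rewrite sqr_ge0.
have maxE : Num.max (W ^+ 2) ((s ^+ 2) ^+ 2) = m ^+ 2.
  rewrite /m; case: (leP W (s ^+ 2)) => h; [rewrite max_r|rewrite max_l];
    rewrite // ler_pXn2r ?nnegrE// ltW//.
have minE : Num.min (W ^+ 2) ((s ^+ 2) ^+ 2) = Num.min W (s ^+ 2) ^+ 2.
  case: (leP W (s ^+ 2)) => h; [rewrite min_l|rewrite min_r];
    rewrite // ler_pXn2r ?nnegrE// ltW//.
rewrite circle_mean_half//.
have := IH (w1 ^+ 2 - w2 ^+ 2) (2 * w1 * w2) (- s ^+ 2).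
rewrite /= norm_sq_sq sqrrN -/W maxE minE => /(_ (exprn_gt0 _ m0)).
have mn0 : 0 <= Num.min W (s ^+ 2) by rewrite le_min W0.
have /[swap]/[apply] : Num.min W (s ^+ 2) ^+ 2 <= q * m ^+ 2.
  apply: (@le_trans _ _ ((q * m) ^+ 2)).
    by rewrite ler_pXn2r ?nnegrE// (le_trans mn0).
  by rewrite exprMn ler_wpM2r ?sqr_ge0// expr2 ler_piMr// ltW.
rewrite lnXn// => IHb.
rewrite (_ : _ - _ = (circle_mean (w1 ^+ 2 - w2 ^+ 2) (2 * w1 * w2) (- s ^+ 2) -
    2 * pi * (ln m *+ 2)) / 2); last by field.
rewrite normrM [X in _ * X]ger0_norm ?invr_ge0// [2 ^+ n.+1]exprS invfM (mulrC 2^-1) mulrA.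
by rewrite ler_wpM2r ?invr_ge0.
Qed.

Lemma ge0_le_exp2_eq0 (x c : R) : 0 <= x -> (forall n, x <= c / 2 ^+ n) -> x = 0.
Proof.
rewrite le_eqVlt => /predU1P[//|x0 xc].
pose n := Num.truncn (c / x).
have cx : c / x < n.+1%:R by exact: truncnS_gt.
have : x <= c / 2 ^+ n.+1 by [].
rewrite ler_pdivlMr ?exprn_gt0// => h.
have : x * n.+1%:R <= x * 2 ^+ n.+1.
  by rewrite ler_pM2l// -natrX ler_nat ltnW// ltn_expl.
move: cx; rewrite ltr_pdivrMr// mulrC; lra.
Qed.

(* The mean of [ln |w + s e^(it)|^2] is doubled when [w, s] are replaced by
   [w ^ 2, - s ^ 2], whereas its distance to [2 pi ln (max |w|^2 s^2)] stays
   bounded along the iteration of this map. *)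
Lemma circle_meanE (w1 w2 s : R) : w1 ^+ 2 + w2 ^+ 2 != s ^+ 2 ->
  circle_mean w1 w2 s = 2 * pi * ln (Num.max (w1 ^+ 2 + w2 ^+ 2) (s ^+ 2)).
Proof.
set W := w1 ^+ 2 + _; set m := Num.max _ _ => ne.
have W0 : 0 <= W by rewrite addr_ge0// sqr_ge0.
have S0 : 0 <= s ^+ 2 by rewrite sqr_ge0.
have mm : Num.min W (s ^+ 2) < m by rewrite /m; case: (ltgtP W (s ^+ 2)) ne.
have mn0 : 0 <= Num.min W (s ^+ 2) by rewrite le_min W0.
have m0 : 0 < m by exact: le_lt_trans mm.
apply/eqP; rewrite -subr_eq0 -normr_eq0; apply/eqP.
apply: (ge0_le_exp2_eq0 _ (2 * pi * - ln ((1 - Num.min W (s ^+ 2) / m) ^+ 2 / 4))) => // n.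
apply: circle_mean_bound_exp => //.
- by apply/andP; split; [rewrite divr_ge0// ltW|rewrite ltr_pdivrMr// mul1r].
- by rewrite divfK// gt_eqF.
Qed.

End jensen.

(** * Bounds on the logarithm and the radial integral over the unit disk *)

Section disk_potential.
Context {R : realType}.
Local Notation mu := (@lebesgue_measure R).

Lemma measurable_diskC : measurable (diskC R : set (R * R)).
Proof.
rewrite (_ : diskC R = (fun z : R * R => z.1 ^+ 2 + z.2 ^+ 2) @^-1` `]-oo, 1]%classic);
  last first.
  by apply/seteqP; split => z; rewrite /= in_itv.
rewrite -[X in measurable X]setTI.
have : measurable_fun setT (fun z : R * R => z.1 ^+ 2 + z.2 ^+ 2).
  by apply: measurable_funD; apply: measurable_funX.
by apply.
Qed.

Lemma measurable_fun_ln_norm d (T : measurableType d) (f g : T -> R) :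
  measurable_fun setT f -> measurable_fun setT g ->
  measurable_fun setT (fun x => ln (Num.sqrt (f x ^+ 2 + g x ^+ 2))).
Proof.
move=> mf mg; apply: (measurableT_comp (@measurable_ln R)).
have ms : measurable_fun setT (@Num.sqrt R).
  by apply: continuous_measurable_fun; exact: sqrt_continuous.
apply: (measurableT_comp ms).
by apply: measurable_funD; apply: measurable_funX.
Qed.

Lemma ln_sqrt (x : R) : 0 < x -> ln (Num.sqrt x) = ln x / 2.
Proof.
move=> x0; have -> : ln x = ln (Num.sqrt x) *+ 2.
  by rewrite -lnXn ?sqrtr_gt0// sqr_sqrtr// ltW.
by field.
Qed.

Lemma ln_norm_add_le (c a1 a2 b1 b2 : R) : ln 3 <= c ->
  a1 ^+ 2 + a2 ^+ 2 <= 4 -> b1 ^+ 2 + b2 ^+ 2 <= 1 ->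
  ln (Num.sqrt ((a1 + b1) ^+ 2 + (a2 + b2) ^+ 2)) <= c.
Proof.
move=> c3 a4 b1'; apply: le_trans c3.
set x := (a1 + b1) ^+ 2 + (a2 + b2) ^+ 2; have : x <= 9.
  (* The extremal case is [a = 2 b]: coordinatewise [(a + b)^2 <= 3/2 a^2 + 3 b^2], which sums to at
     most [6 + 3]. *)
  rewrite /x; have := sqr_ge0 (a1 - 2 * b1); have := sqr_ge0 (a2 - 2 * b2).
  nra.
have x0 : 0 <= x by rewrite /x addr_ge0 ?sqr_ge0.
move=> x9; have [xp|] := ltP 0 (Num.sqrt x).
  rewrite ler_ln ?posrE// -(@ger0_norm _ (3 : R))// -sqrtr_sqr ler_wsqrtr//.
  by rewrite -natrX.
(* At [a + b = 0] the logarithm takes its default value 0, still below [ln 3]. *)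
by move=> h; rewrite ln0// ln_ge0//; lra.
Qed.

Lemma sin_atan (m : R) : sin (atan m) = m * sqrt1V m.
Proof.
have c0 : cos (atan m) != 0 by rewrite gt_eqF// cos_gt0_pihalf// atan_gtNpi2 atan_ltpi2.
by rewrite -{2}(atanK m) /tan /sqrt1V -cos_atan divfK.
Qed.

Lemma circle_dist2N (w1 w2 s t : R) : circle_dist2 w1 w2 (- s) t =
  circle_dist2 w1 w2 s (t + pi).
Proof. by rewrite /circle_dist2 cosDpi sinDpi !mulrN !mulNr. Qed.

Lemma integral_ln_circle_dist2_double (w1 w2 s : R) : w1 ^+ 2 + w2 ^+ 2 != s ^+ 2 ->
  \int[mu]_(t in `[- (pi / 2), pi / 2]) ln (circle_dist2 w1 w2 s (2 * t)) =
  pi * ln (Num.max (w1 ^+ 2 + w2 ^+ 2) (s ^+ 2)).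
Proof.
move=> ne; have p0 := pi_gt0 R.
have neN : w1 ^+ 2 + w2 ^+ 2 != (- s) ^+ 2 by rewrite sqrrN.
have cf : continuous (fun t : R => ln (circle_dist2 w1 w2 s (2 * t))).
  move=> t; apply: (@continuous_comp R R R (fun t => 2 * t) (@ln R \o circle_dist2 w1 w2 s)).
    by apply: cvgM; [exact: cvg_cst|exact: cvg_id].
  exact: continuous_ln_circle_dist2.
(* Substituting [t / 2 - pi / 2] for [t] turns the angle [2 t] into [t - pi], whence the sign change
   of [s]. *)
have -> : \int[mu]_(t in `[- (pi / 2), pi / 2]) ln (circle_dist2 w1 w2 s (2 * t)) =
    2^-1 * circle_mean w1 w2 (- s).
  rewrite /circle_mean -RintegralZl//; last first.
    exact: (continuous_integrable_itv _ _ _ (continuous_ln_circle_dist2 _ _ _ neN)).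
  rewrite /Rintegral; congr fine.
  have tp0 : 0 <= 2 * pi :> R by rewrite mulr_ge0// ltW.
  have := @integral_itv_affine R 2^-1 (- (pi / 2)) 0 (2 * pi)
    (fun t => ln (circle_dist2 w1 w2 s (2 * t))) _ tp0.
  rewrite mulr0 add0r (_ : 2^-1 * (2 * pi) - pi / 2 = pi / 2); last by field.
  move=> ->; [|by rewrite invr_gt0|exact: continuous_subspaceT].
  apply: eq_integral => t _; congr (_ * ln _)%:E.
  rewrite circle_dist2N (_ : 2 * _ = t - pi); last by field.
  by rewrite /circle_dist2 cosB sinB cospi sinpi cosDpi sinDpi; ring.
by rewrite circle_meanE// sqrrN; field.
Qed.

(* [pi * disk_mean_ln A] is the integral of [ln |a + y|] over the unit disk
   [|y| <= 1], where [A = |a|^2]. *)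
Definition disk_mean_ln (A : R) : R := if A <= 1 then (A - 1) / 2 else ln A / 2.

Lemma is_derive_sqr_ln_sqr (r : R) : 0 < r ->
  is_derive r 1 (fun r => r ^+ 2 / 2 * ln (r ^+ 2) - r ^+ 2 / 2) (r * ln (r ^+ 2)).
Proof.
move=> r0; have r20 : 0 < r ^+ 2 by rewrite exprn_gt0.
have dl : is_derive (r ^+ 2) 1 (@ln R) (r ^+ 2)^-1 by exact: is_derive1_ln.
apply: is_derive_eq; rewrite /GRing.scale/=; field; lra.
Qed.

(** The integrand collects the radii [r] and [-r]: two copies of [c], and the logarithm of a squared
    modulus. The maximum switches at [r = sqrt A], inside the range only when [A < 1]. *)
Lemma integral_radial_ln_max (c A : R) : 0 < A ->
  (\int[mu]_(r in `[0%R, 1%R]) (r * (pi * (2 * c - ln (Num.max A (r ^+ 2)))))%:E =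
  (pi * (c - disk_mean_ln A))%:E)%E.
Proof.
move=> A0; rewrite /disk_mean_ln.
have int_cst (k x : R) : 0 <= x ->
    (\int[mu]_(r in `[0%R, x]) (r * k)%:E = (x ^+ 2 / 2 * k)%:E)%E.
  move=> x0; apply: etrans; first apply: (@FTC2_is_derive R _ (fun r => r ^+ 2 / 2 * k)) => //.
  - by move=> r _; apply: cvgM; [exact: cvg_id|exact: cvg_cst].
  - by move=> r _; apply: is_derive_eq; rewrite /GRing.scale/=; field.
  - by rewrite /= expr0n/= !mul0r subr0.
have [A1|A1] := leP 1 A.
  transitivity (\int[mu]_(r in `[0%R, 1%R]) (r * (pi * (2 * c - ln A)))%:E)%E.
    apply: eq_integral => r; rewrite inE/= in_itv/= => /andP[r0 r1].
    by rewrite max_l// (le_trans _ A1)// expr_le1.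
  rewrite int_cst//; congr EFin; case: ifPn => [A1'|_]; last by field.
  (* Both branches of [disk_mean_ln] agree at this boundary value. *)
  have -> : A = 1 by apply/le_anti/andP.
  by rewrite ln1; field.
rewrite ltW//.
pose a := Num.sqrt A; have a0 : 0 < a by rewrite sqrtr_gt0.
have a2 : a ^+ 2 = A by rewrite sqr_sqrtr// ltW.
have a1 : a <= 1 by rewrite -(@expr_le1 _ 2)// ?a2 ltW.
have cmax : continuous (fun r : R => r * (pi * (2 * c - ln (Num.max A (r ^+ 2))))).
  move=> r; apply: cvgM; first exact: cvg_id.
  apply: cvgM; first exact: cvg_cst.
  apply: cvgB; first exact: cvg_cst.
  apply: (@continuous_comp R R R (fun r => Num.max A (r ^+ 2)) (@ln R)).
    apply: (@continuous_max R R (fun=> A) (fun r => r ^+ 2)); first exact: cvg_cst.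
    exact: exprn_continuous.
  by apply: continuous_ln; rewrite lt_max A0.
rewrite -[LHS]fineK; last first.
  apply: integrable_fin_num => //; exact: continuous_integrable_itv cmax.
have := @Rintegral_itv_split _ _ 0 a 1 (ltW a0) a1 (continuous_integrable_itv _ 0 1 cmax).
rewrite /Rintegral => ->.
have -> : (\int[mu]_(r in `[0%R, a]) (r * (pi * (2 * c - ln (Num.max A (r ^+ 2)))))%:E =
   (A / 2 * (pi * (2 * c - ln A)))%:E)%E.
  rewrite -a2 -int_cst ?ltW// a2; apply: eq_integral => r;
    rewrite inE/= in_itv/= => /andP[r0 ra].
  by rewrite max_l// -a2 ler_pXn2r ?nnegrE// ltW.
have -> : (\int[mu]_(r in `[a, 1%R]) (r * (pi * (2 * c - ln (Num.max A (r ^+ 2)))))%:E =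
   (pi * (c + 1 / 2) - pi * (c * A - (A / 2 * ln A - A / 2)))%:E)%E.
  apply: etrans; first apply: (@FTC2_is_derive R _ (fun r =>
    pi * (c * r ^+ 2 - (r ^+ 2 / 2 * ln (r ^+ 2) - r ^+ 2 / 2))) a 1 a1).
  - by move=> r _; exact: cmax.
  - move=> r /andP[ar r1]; have r0 : 0 < r by exact: lt_le_trans ar.
    have dr := is_derive_sqr_ln_sqr _ r0.
    rewrite max_r; last by rewrite -a2 ler_pXn2r ?nnegrE// ltW.
    apply: is_derive_eq; rewrite /GRing.scale/=; ring.
  - by rewrite /= expr1n ln1 a2; congr EFin; field.
by rewrite /=; congr EFin; field.
Qed.

End disk_potential.

(** * Integration over directions at a fixed radius *)

Section angular_mean.
Context {R : realType}.
Local Notation mu := (@lebesgue_measure R).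
Local Open Scope ereal_scope.

Definition log_dist (u y : R * R) : R :=
  ln (Num.sqrt ((u.1 + y.1) ^+ 2 + (u.2 + y.2) ^+ 2)).

Definition disk_integrand (c : R) (u : R * R) : R * R -> \bar R :=
  (fun y => (c - log_dist u y)%:E) \_ (diskC R).

Lemma measurable_log_dist : measurable_fun setT (fun p : (R * R) * (R * R) => log_dist p.1 p.2).
Proof.
by apply: measurable_fun_ln_norm; apply: measurable_funD => //; exact: measurableT_comp.
Qed.

Lemma measurable_disk_integrand c u : measurable_fun setT (disk_integrand c u).
Proof.
apply/(measurable_restrictT _ measurable_diskC).
apply: measurable_funTS; apply/measurable_EFinP; apply: measurable_funB => //.
exact: (measurable_fun_pair2 u measurable_log_dist).
Qed.

Lemma disk_integrand_ge0 c u y : (ln 3 <= c)%R -> (u.1 ^+ 2 + u.2 ^+ 2 <= 4)%R ->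
  0 <= disk_integrand c u y.
Proof.
move=> c3 u4; rewrite /disk_integrand patchE; case: ifPn => //.
by rewrite inE /diskC/= => y1; rewrite lee_fin subr_ge0 ln_norm_add_le.
Qed.

Definition angular_mean (c : R) (u : R * R) (r : R) : \bar R :=
  \int[mu]_m polar_integrand (disk_integrand c u) m r.

Lemma sqrt1V_sqr (m : R) : (sqrt1V m ^+ 2 = (1 + m ^+ 2)^-1)%R.
Proof. by rewrite /sqrt1V exprVn sqr_sqrtr// addr_ge0// sqr_ge0. Qed.

Lemma polar_norm (m r : R) :
  ((r * sqrt1V m) ^+ 2 + (r * (m * sqrt1V m)) ^+ 2 = r ^+ 2)%R.
Proof. by rewrite -sin_atan /sqrt1V -cos_atan !exprMn -mulrDr cos2Dsin2 mulr1. Qed.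

(** The substitution [m = tan t] absorbs [1 / (1 + m^2)]. As [|u|] differs from [|r|], the distance
    never vanishes and the integrand is continuous. Only a half turn of angles appears; the other
    half belongs to [-r]. *)
Lemma angular_meanE c u r : (ln 3 <= c)%R -> (u.1 ^+ 2 + u.2 ^+ 2 <= 4)%R ->
  (r ^+ 2 <= 1)%R -> (u.1 ^+ 2 + u.2 ^+ 2 != r ^+ 2)%R ->
  angular_mean c u r = (\int[mu]_(t in `[(- (pi / 2))%R, (pi / 2)%R])
    (`|r| * (c - ln (circle_dist2 u.1 u.2 r t) / 2)))%R%:E.
Proof.
move=> c3 u4 r1 ne.
pose g t := (`|r| * (c - ln (circle_dist2 u.1 u.2 r t) / 2))%R.
have cg : continuous g.
  move=> t; apply: cvgM; first exact: cvg_cst.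
  apply: cvgB; first exact: cvg_cst.
  apply: cvgM; last exact: cvg_cst.
  exact: continuous_ln_circle_dist2.
have d0 t := circle_dist2_gt0 _ _ _ t ne.
have g0 t : (0 <= g t)%R.
  rewrite /g mulr_ge0// subr_ge0 -ln_sqrt// ln_norm_add_le//.
  by rewrite !exprMn -mulrDr cos2Dsin2 mulr1.
transitivity (\int[mu]_m (g (atan m) / (1 + m ^+ 2))%:E).
  apply: eq_integral => m _.
  rewrite /polar_integrand /disk_integrand patchE ifT; last first.
    by rewrite inE /diskC/= polar_norm.
  rewrite -EFinM; congr EFin; rewrite /g -ln_sqrt// /log_dist/= /circle_dist2.
  by rewrite sin_atan cos_atan -/(sqrt1V m) sqrt1V_sqr; ring.
rewrite (ge0_integral_tan (g \o atan)); [|move=> m|by move=> m; exact: g0]; last first.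
  by apply: continuous_comp; [exact: continuous_atan|exact: cg].
transitivity (\int[mu]_(t in `](- (pi / 2))%R, (pi / 2)%R[) (g t)%:E).
  by apply: eq_integral => t; rewrite inE/= => tpi; rewrite tanK.
rewrite -(integral_itv_bndoo true false); last first.
  by apply/measurable_EFinP; apply: measurable_funTS; exact: continuous_measurable_fun.
rewrite -[LHS]fineK//; apply: integrable_fin_num => //.
exact: (continuous_integrable_itv g).
Qed.

(** Together [r] and [-r] cover the circle by antipodal pairs; each pair merges into one logarithm
    at the angle [2 t], to which Jensen's formula applies with [w^2] and [-r^2]. *)
Lemma angular_mean_sym c u r : (ln 3 <= c)%R -> (u.1 ^+ 2 + u.2 ^+ 2 <= 4)%R ->
  (0 < r <= 1)%R -> (u.1 ^+ 2 + u.2 ^+ 2 != r ^+ 2)%R ->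
  angular_mean c u r + angular_mean c u (- r)%R =
  (r * (pi * (2 * c - ln (Num.max (u.1 ^+ 2 + u.2 ^+ 2) (r ^+ 2)))))%:E.
Proof.
move=> c3 u4 /andP[r0 r1] ne.
have r21 : (r ^+ 2 <= 1)%R by rewrite expr_le1// ltW.
have neN : (u.1 ^+ 2 + u.2 ^+ 2 != (- r) ^+ 2)%R by rewrite sqrrN.
rewrite !angular_meanE ?sqrrN// -EFinD; congr EFin.
set A := (u.1 ^+ 2 + u.2 ^+ 2)%R in ne neN u4 *.
have A0 : (0 <= A)%R by rewrite addr_ge0// sqr_ge0.
have cl s : (A != s ^+ 2)%R -> continuous (fun t =>
  (`|r| * (c - ln (circle_dist2 u.1 u.2 s t) / 2))%R).
  move=> ns t; apply: cvgM; first exact: cvg_cst.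
  apply: cvgB; first exact: cvg_cst.
  apply: cvgM; last exact: cvg_cst.
  exact: continuous_ln_circle_dist2.
rewrite normrN -RintegralD//; [|exact: continuous_integrable_itv (cl _ _)..].
have ne2 : ((u.1 ^+ 2 - u.2 ^+ 2) ^+ 2 + (2 * u.1 * u.2) ^+ 2 != (- r ^+ 2) ^+ 2)%R.
  by rewrite norm_sq_sq sqrrN eqrXn2 ?sqr_ge0.
pose h t := ln (circle_dist2 (u.1 ^+ 2 - u.2 ^+ 2)%R (2 * u.1 * u.2)%R (- r ^+ 2)%R (2 * t)%R).
transitivity (\int[mu]_(t in `[(- (pi / 2))%R, (pi / 2)%R]) (2 * r * c - r / 2 * h t))%R.
  apply: eq_Rintegral => t _; rewrite /h -circle_dist2_mul lnM ?posrE ?circle_dist2_gt0//.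
  by rewrite circle_dist2N gtr0_norm//; field.
have ch : continuous h.
  move=> t; apply: (@continuous_comp R R R (fun t =>
    2 * t)%R (@ln R \o circle_dist2 (u.1 ^+ 2 - u.2 ^+ 2) (2 * u.1 * u.2) (- r ^+ 2))%R).
    by apply: cvgM; [exact: cvg_cst|exact: cvg_id].
  exact: continuous_ln_circle_dist2.
have p0 := pi_gt0 R.
rewrite RintegralB//; last 2 first.
- by apply: (continuous_integrable_itv (fun=> 2 * r * c)%R) => t; exact: cvg_cst.
- by apply: (continuous_integrable_itv (fun t => r / 2 * h t)%R) => t; apply: cvgM;
  [exact: cvg_cst|exact: ch].
rewrite [X in (_ - X)%R]RintegralZl//; last exact: (continuous_integrable_itv h _ _ ch).
rewrite integral_ln_circle_dist2_double// norm_sq_sq sqrrN.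
rewrite Rintegral_cst//= lebesgue_measure_itv/= lte_fin ifT; last by lra.
have -> : Num.max (A ^+ 2)%R ((r ^+ 2) ^+ 2)%R = (Num.max A (r ^+ 2) ^+ 2)%R.
  case: (leP A (r ^+ 2)%R) => h'; [rewrite max_r|rewrite max_l];
    rewrite // ler_pXn2r ?nnegrE ?sqr_ge0// ltW//.
rewrite lnXn ?lt_max ?exprn_gt0 ?orbT//= .
by field.
Qed.

End angular_mean.

(** * The integral of the shifted logarithm over the unit disk *)

Section disk_integral.
Context {R : realType}.
Local Notation mu := (@lebesgue_measure R).
Local Open Scope ereal_scope.

Lemma ge0_integral_fold (f : R -> \bar R) : measurable_fun setT f ->
  (forall x, 0 <= f x) ->
  \int[mu]_x f x = \int[mu]_(x in `]0%R, +oo[) (f x + f (- x)%R).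
Proof.
move=> mf f0.
have mfN : measurable_fun setT (fun x : R => f (- x)%R) by exact: measurableT_comp.
rewrite ge0_integralD//; [|exact: measurable_funTS..].
have := ge0_integration_by_substitution0 mfN (fun x => f0 (- x)%R).
rewrite -integral_itv_obnd_cbnd; last exact: measurable_funTS.
move=> ->; under [X in _ + X]eq_integral do rewrite opprK.
rewrite addeC -ge0_integral_setU//.
- by rewrite -setCitvl setUv.
- by rewrite -setCitvl setUv.
- by rewrite -setCitvl; apply/disj_setPCl.
Qed.

Lemma measurable_angular_mean c u : (ln 3 <= c)%R -> (u.1 ^+ 2 + u.2 ^+ 2 <= 4)%R ->
  measurable_fun setT (@angular_mean R c u).
Proof.
move=> c3 u4; apply: (@measurable_fun_fubini_tonelli_G _ _ _ _ _ mu
  (fun p => polar_integrand (disk_integrand c u) p.1 p.2)).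
  by apply: measurable_polar_integrand; exact: measurable_disk_integrand.
by move=> p; rewrite mule_ge0 ?disk_integrand_ge0// lee_fin mulr_ge0// sqr_ge0.
Qed.

Lemma angular_mean_ge0 c u r : (ln 3 <= c)%R -> (u.1 ^+ 2 + u.2 ^+ 2 <= 4)%R ->
  0 <= @angular_mean R c u r.
Proof.
move=> c3 u4; apply: integral_ge0 => m _.
by rewrite mule_ge0 ?disk_integrand_ge0// lee_fin mulr_ge0// sqr_ge0.
Qed.

Lemma angular_mean0 c u r : (1 < r ^+ 2)%R -> @angular_mean R c u r = 0.
Proof.
move=> r1; apply: integral0_eq => m _.
rewrite /polar_integrand /disk_integrand patchE ifF ?mul0e//.
by apply/negP; rewrite inE /diskC/= polar_norm leNgt r1.
Qed.

Lemma integral_disk_integrand c u : (ln 3 <= c)%R ->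
  (0 < u.1 ^+ 2 + u.2 ^+ 2 <= 4)%R ->
  \int[mu \x mu]_y disk_integrand c u y =
  (pi * (c - disk_mean_ln (u.1 ^+ 2 + u.2 ^+ 2)))%:E.
Proof.
move=> c3 /andP[A0 A4].
have dge0 y := disk_integrand_ge0 c u y c3 A4.
have mPhi := measurable_angular_mean _ _ c3 A4.
have Phi0 r := angular_mean_ge0 _ _ r c3 A4.
rewrite (ge0_integral_slope_polar _ (measurable_disk_integrand c u) dge0).
transitivity (\int[mu]_r angular_mean c u r).
  apply: (@fubini_tonelli _ _ _ _ _ mu mu
    (fun p => polar_integrand (disk_integrand c u) p.1 p.2)).
    by apply: measurable_polar_integrand; exact: measurable_disk_integrand.
  by move=> p; rewrite mule_ge0// lee_fin mulr_ge0// sqr_ge0.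
rewrite (ge0_integral_fold _ mPhi Phi0).
pose S r := angular_mean c u r + angular_mean c u (- r)%R.
pose K r := (r * (pi * (2 * c - ln (Num.max (u.1 ^+ 2 + u.2 ^+ 2) (r ^+ 2)))))%R.
have mS : measurable_fun setT S.
  by apply: emeasurable_funD => //; exact: measurableT_comp.
have mK : measurable_fun setT (fun r => (K r)%:E).
  apply/measurable_EFinP; apply: measurable_funM => //; apply: measurable_funM => //.
  apply: measurable_funB => //; apply: (measurableT_comp (@measurable_ln R)).
  by apply: measurable_maxr => //; exact: measurable_funX.
transitivity (\int[mu]_(r in `]0%R, 1%R]) S r).
  rewrite integral_mkcond [RHS]integral_mkcond; apply: eq_integral => r _.
  rewrite !patchE !mem_setE !in_itv/= andbT.
  case: (ltP 0%R r) => //= r0; case: (leP r 1%R) => //= r1.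
  by rewrite /S !angular_mean0 ?adde0// ?sqrrN exprn_egt1.
(* The angular formula excludes the single radius [r = |u|], which is removed as a null set and then
   restored. *)
pose a := Num.sqrt (u.1 ^+ 2 + u.2 ^+ 2).
have mD : measurable (`]0%R, 1%R]%classic `\ a : set (measurableTypeR R)).
  by apply: measurableD.
rewrite -(@integral_setD1 _ _ a)//; last exact: measurable_funTS.
transitivity (\int[mu]_(r in `]0%R, 1%R] `\ a) (K r)%:E).
  apply: eq_integral => r; rewrite inE/= in_itv/= => -[/andP[r0 r1] ra].
  apply: angular_mean_sym => //; first by rewrite r0.
  apply/eqP => e; apply: ra; rewrite /a e sqrtr_sqr gtr0_norm//.
rewrite integral_setD1//; last exact: measurable_funTS.
rewrite integral_itv_obnd_cbnd; last exact: measurable_funTS.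
exact: integral_radial_ln_max.
Qed.

End disk_integral.

(** * Sigma-finiteness of Lebesgue measure on the plane *)

Section leb2.
Context {R : realType}.
Local Notation mu := (@lebesgue_measure R).
Local Open Scope ereal_scope.

(* The product measure of the library is canonically sigma-finite only for
   subprobabilities, whence this alias and its instances. *)
Definition leb2 : set (measurableTypeR R * measurableTypeR R) -> \bar R := mu \x mu.

HB.instance Definition _ := Measure.on leb2.

Lemma sigma_finite_leb2 : sigma_finite setT leb2.
Proof.
have /sigma_finiteP[{}F [{}TF ndF {}Foo]] := sigma_finiteT mu.
exists (fun n => F n `*` F n).
  rewrite -setXTT TF predeqE => -[x y]; split.
    move=> [/= [n _ Fnx] [k _ Fky]]; exists (maxn n k) => //; split.
    - by move: x Fnx; exact/subsetPset/ndF/leq_maxl.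
    - by move: y Fky; exact/subsetPset/ndF/leq_maxr.
  by move=> [n _ []/= ? ?]; split; exists n.
move=> k; have [? ?] := Foo k.
split; first exact: measurableX.
by rewrite /leb2 product_measure1E// lte_mul_pinfty// ge0_fin_numE.
Qed.

HB.instance Definition _ := Measure_isSigmaFinite.Build _ _ _ leb2 sigma_finite_leb2.
End leb2.

(** * Reduction of the bidisk integral to one integral in the angle *)

Section bidisk.
Context {R : realType}.
Local Notation mu := (@lebesgue_measure R).
Local Open Scope ereal_scope.

(* [radial_ln (rho ^ 2)] is the integral of [r * disk_mean_ln (r ^ 2)] over
   [0 <= r <= rho]. *)
Definition radial_ln (s : R) : R :=
  (Num.min s 1 ^+ 2 / 8 + s / 4 * ln (Num.max s 1) - s / 4)%R.

Lemma continuous_radial_ln : continuous radial_ln.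
Proof.
move=> s; apply: cvgB.
  apply: cvgD.
    apply: cvgM; last exact: cvg_cst.
    apply: (@continuous_comp R R R (fun s => Num.min s 1) (fun s => s ^+ 2))%R.
      by apply: (@continuous_min R R id (fun=> 1%R)); [exact: cvg_id|exact: cvg_cst].
    exact: exprn_continuous.
  apply: cvgM; first by apply: cvgM; [exact: cvg_id|exact: cvg_cst].
  apply: (@continuous_comp R R R (fun s => Num.max s 1)%R (@ln R)).
    by apply: (@continuous_max R R id (fun=> 1%R)); [exact: cvg_id|exact: cvg_cst].
  by apply: continuous_ln; rewrite lt_max ltr01 orbT.
by apply: cvgM; [exact: cvg_id|exact: cvg_cst].
Qed.

(** In this branch-free form continuity across [s = 1] is immediate. *)
Lemma disk_mean_lnE (s : R) :
  disk_mean_ln s = ((Num.min s 1 - 1) / 2 + ln (Num.max s 1) / 2)%R.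
Proof.
rewrite /disk_mean_ln; case: (leP s 1%R) => _.
  by rewrite ln1 mul0r addr0.
by rewrite subrr mul0r add0r.
Qed.

Lemma continuous_disk_mean_ln_sqr : continuous (fun r : R => disk_mean_ln (r ^+ 2)).
Proof.
rewrite (_ : (fun r : R => _) = (fun s => (Num.min s 1 - 1) / 2 + ln (Num.max s 1) / 2)%R
  \o (fun r => r ^+ 2)%R); last first.
  by apply/funext => r /=; rewrite disk_mean_lnE.
move=> r; apply: continuous_comp; first exact: exprn_continuous.
apply: cvgD.
  apply: cvgM; last exact: cvg_cst.
  apply: cvgB; last exact: cvg_cst.
  by apply: (@continuous_min R R id (fun=> 1%R)); [exact: cvg_id|exact: cvg_cst].
apply: cvgM; last exact: cvg_cst.
apply: (@continuous_comp R R R (fun s => Num.max s 1)%R (@ln R)).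
  by apply: (@continuous_max R R id (fun=> 1%R)); [exact: cvg_id|exact: cvg_cst].
by apply: continuous_ln; rewrite lt_max ltr01 orbT.
Qed.

Lemma integral_radial (c rho : R) : (0 <= rho)%R ->
  \int[mu]_(r in `[0%R, rho]) (r * (c - disk_mean_ln (r ^+ 2)))%:E =
  (c * rho ^+ 2 / 2 - radial_ln (rho ^+ 2))%:E.
Proof.
move=> rho0.
pose f (r : R) := (r * (c - disk_mean_ln (r ^+ 2)))%R.
have cf : continuous f.
  move=> r; apply: cvgM; first exact: cvg_id.
  by apply: cvgB; [exact: cvg_cst|exact: continuous_disk_mean_ln_sqr].
have small x : (0 <= x <= 1)%R -> \int[mu]_(r in `[0%R, x]) (f r)%:E =
    (c * x ^+ 2 / 2 - radial_ln (x ^+ 2))%:E.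
  move=> /andP[x0 x1].
  transitivity (\int[mu]_(r in `[0%R, x]) (r * (c - (r ^+ 2 - 1) / 2))%:E).
    apply: eq_integral => r; rewrite inE/= in_itv/= => /andP[r0 rx].
    by rewrite /f /disk_mean_ln ifT// expr_le1// (le_trans rx).
  apply: etrans; first apply: (@FTC2_is_derive R _ (fun r =>
    c * r ^+ 2 / 2 - r ^+ 4 / 8 + r ^+ 2 / 4)%R 0%R x x0).
  - move=> r _; apply: cvgM; first exact: cvg_id.
    apply: cvgB; first exact: cvg_cst.
    apply: cvgM; last exact: cvg_cst.
    apply: cvgB; last exact: cvg_cst.
    exact: exprn_continuous.
  - move=> r _; apply: is_derive_eq; rewrite /GRing.scale/=; by field.
  - rewrite /= /radial_ln min_l ?expr_le1// max_r ?expr_le1// ln1.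
    by congr EFin; field.
have [rho1|rho1] := leP rho 1%R; first by apply: small; rewrite rho0.
rewrite -[LHS]fineK; last first.
  apply: integrable_fin_num => //; exact: continuous_integrable_itv cf.
have := @Rintegral_itv_split _ _ 0%R 1%R rho ler01 (ltW rho1)
  (continuous_integrable_itv _ 0%R rho cf).
rewrite /Rintegral => ->; rewrite small ?ler01 ?lexx//.
have -> : \int[mu]_(r in `[1%R, rho]) (f r)%:E =
    (c * rho ^+ 2 / 2 - (rho ^+ 2 / 2 * ln (rho ^+ 2) - rho ^+ 2 / 2) / 2 - c / 2 - 1 / 4)%:E.
  apply: etrans; first apply: (@FTC2_is_derive R _ (fun r =>
    c * r ^+ 2 / 2 - (r ^+ 2 / 2 * ln (r ^+ 2) - r ^+ 2 / 2) / 2)%R 1%R rho (ltW rho1)).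
  - by move=> r _; exact: cf.
  - move=> r /andP[r1 _]; have r0 : (0 < r)%R by exact: lt_le_trans r1.
    have dr := is_derive_sqr_ln_sqr _ r0.
    rewrite /f disk_mean_lnE min_r ?expr_ge1 ?(ltW r0)// max_l ?expr_ge1 ?(ltW r0)//.
    by apply: is_derive_eq; rewrite /GRing.scale/=; field.
  - by rewrite /= expr1n ln1; congr EFin; field.
rewrite /= /radial_ln expr1n min_l// max_l// ln1.
rewrite min_r ?expr_ge1 ?(ltW rho1)// max_l ?expr_ge1 ?(ltW rho1)//.
by congr EFin; field.
Qed.

(** Gives the nonnegativity that [ge0_integral_tan] asks of the angular integrand. The key estimate
    is [max s 1 <= 4 <= 3^2], so its logarithm is at most [2 c]. *)
Lemma radial_ln_le (c s : R) : (ln 3 <= c)%R -> (0 <= s <= 4)%R -> (radial_ln s <= c * s / 2)%R.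
Proof.
move=> c3 /andP[s0 s4]; rewrite /radial_ln.
have h1 : (Num.min s 1 ^+ 2 <= s)%R.
  case: (leP s 1%R) => s1; last by rewrite expr1n ltW.
  by rewrite expr2 ler_piMr.
have h2 : (ln (Num.max s 1) <= 2 * c)%R.
  have : (ln (Num.max s 1) <= ln (3 ^+ 2))%R.
    rewrite ler_ln ?posrE ?lt_max ?ltr01 ?orbT ?exprn_gt0// ge_max.
    by apply/andP; split; lra.
  rewrite lnXn// mulr2n; lra.
have : (s / 4 * ln (Num.max s 1) <= s / 4 * (2 * c))%R by rewrite ler_wpM2l// divr_ge0.
lra.
Qed.

(* [1 + x] ranges over this disk when [x] ranges over the unit disk. *)
Definition shifted_disk : set (R * R) := [set u | ((u.1 - 1) ^+ 2 + u.2 ^+ 2 <= 1)%R].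

Definition shifted_integrand (c : R) (p : (R * R) * (R * R)) : \bar R :=
  ((fun p => (c - log_dist p.1 p.2)%:E) \_ (shifted_disk `*` diskC R)) p.

Lemma measurable_shifted_disk : measurable shifted_disk.
Proof.
rewrite (_ : shifted_disk = (fun z : R * R =>
  (z.1 - 1) ^+ 2 + z.2 ^+ 2)%R @^-1` `]-oo, 1%R]%classic); last first.
  by apply/seteqP; split => z; rewrite /= in_itv.
rewrite -[X in measurable X]setTI.
have : measurable_fun setT (fun z : R * R => (z.1 - 1) ^+ 2 + z.2 ^+ 2)%R.
  by apply: measurable_funD; apply: measurable_funX => //; exact: measurable_funB.
by apply.
Qed.

Lemma measurable_shifted_integrand c : measurable_fun setT (shifted_integrand c).
Proof.
have mD : measurable (shifted_disk `*` diskC R).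
  by apply: measurableX; [exact: measurable_shifted_disk|exact: measurable_diskC].
apply/(measurable_restrictT _ mD).
by apply: measurable_funTS; apply/measurable_EFinP; apply: measurable_funB => //;
  exact: measurable_log_dist.
Qed.

Lemma shifted_disk_le4 u : shifted_disk u -> (u.1 ^+ 2 + u.2 ^+ 2 <= 4)%R.
Proof.
rewrite /shifted_disk/= => h.
have := sqr_ge0 (u.1 - 2)%R; have := sqr_ge0 u.2; nra.
Qed.

Lemma shifted_integrand_ge0 c p : (ln 3 <= c)%R -> 0 <= shifted_integrand c p.
Proof.
move=> c3; rewrite /shifted_integrand patchE; case: ifPn => //.
rewrite inE => -[/shifted_disk_le4 p1 p2].
by rewrite lee_fin subr_ge0 ln_norm_add_le.
Qed.

Definition shifted_mean (c : R) (u : R * R) : \bar R :=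
  \int[leb2]_y shifted_integrand c (u, y).

Lemma shifted_mean_ge0 c u : (ln 3 <= c)%R -> 0 <= shifted_mean c u.
Proof. by move=> c3; apply: integral_ge0 => y _; exact: shifted_integrand_ge0. Qed.

Lemma measurable_shifted_mean c : (ln 3 <= c)%R -> measurable_fun setT (shifted_mean c).
Proof.
move=> c3.
have f0 p := shifted_integrand_ge0 c p c3.
exact: (@measurable_fun_fubini_tonelli_F _ _ _ _ R (@leb2 R) _
  (measurable_shifted_integrand c) f0).
Qed.

Lemma shifted_mean_out c u : ~ shifted_disk u -> shifted_mean c u = 0.
Proof.
move=> Du; apply: integral0_eq => y _; rewrite /shifted_integrand patchE ifF//.
by apply/negP; rewrite inE => -[].
Qed.

Lemma shifted_mean_in c u : (ln 3 <= c)%R -> shifted_disk u ->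
  (0 < u.1 ^+ 2 + u.2 ^+ 2)%R ->
  shifted_mean c u = (pi * (c - disk_mean_ln (u.1 ^+ 2 + u.2 ^+ 2)))%:E.
Proof.
move=> c3 Du u0; rewrite -integral_disk_integrand// ?u0 ?shifted_disk_le4//.
apply: eq_integral => y _; rewrite /shifted_integrand /disk_integrand !patchE.
by congr (if _ then _ else _); apply/idP/idP; rewrite !inE => // -[].
Qed.

(** Passing from [x] to [1 + x] translates only the real part, so the affine lemma with [k = d = 1],
    applied to the outermost integral, suffices. *)
Lemma integral_bidisk_shifted_mean c : (ln 3 <= c)%R ->
  \int[leb2 \x leb2]_(p in bidisk R) (c - log_abs_1xy R p)%:E =
  \int[leb2]_u shifted_mean c u.
Proof.
move=> c3.
pose shift (x : R * R) : R * R := (x.1 + 1, x.2)%R.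
pose f (p : (R * R) * (R * R)) := shifted_integrand c (shift p.1, p.2).
have f0 p : 0 <= f p by exact: shifted_integrand_ge0.
have mshift : measurable_fun setT shift.
  by apply: measurable_fun_pair => //=; exact: measurable_funD.
have mf : measurable_fun setT f.
  apply: (measurableT_comp (measurable_shifted_integrand c)).
  by apply: measurable_fun_pair => //=; exact: measurableT_comp.
have msm := measurable_shifted_mean _ c3.
have sm0 u := shifted_mean_ge0 _ u c3.
transitivity (\int[leb2 \x leb2]_p f p).
  rewrite integral_mkcond; apply: eq_integral => -[[x1 x2] [y1 y2]] _.
  rewrite /f /shifted_integrand !patchE /=.
  have -> : ((x1 + 1, x2, (y1, y2)) \in shifted_disk `*` diskC R)%R =
    ((x1, x2, (y1, y2)) \in bidisk R).
    by apply/idP/idP; rewrite !inE /shifted_disk /bidisk/= addrK.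
  by case: ifP => // _; rewrite /log_abs_1xy /log_dist/= (addrC 1%R x1).
rewrite (@fubini_tonelli1 _ _ _ _ R leb2 leb2 f mf f0).
transitivity (\int[leb2]_x (shifted_mean c \o shift) x); first exact: eq_integral.
have mss : measurable_fun setT (shifted_mean c \o shift) := measurableT_comp msm mshift.
have ss0 u : 0 <= (shifted_mean c \o shift) u by exact: sm0.
apply: (etrans (@fubini_tonelli1 _ _ _ _ R mu mu _ mss ss0)).
apply: esym; apply: (etrans (@fubini_tonelli1 _ _ _ _ R mu mu _ msm sm0)).
have mF := @measurable_fun_fubini_tonelli_F _ _ _ _ R mu _ msm sm0.
have F0 x : 0 <= fubini_F mu (shifted_mean c) x by apply: integral_ge0 => y _; exact: sm0.
apply: (etrans (@ge0_integral_affine R 1 1 _ (oner_neq0 _) mF F0)).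
rewrite normr1 mul1e; apply: eq_integral => x _; apply: eq_integral => y _.
by rewrite /= /shift mul1r.
Qed.

(** The line of slope [m] meets the shifted disk exactly in [0 <= r <= 2 * sqrt1V m], and
    [4 / (1 + m^2)] is the square of the far endpoint. *)
Lemma polar_shifted_mean c m : (ln 3 <= c)%R ->
  \int[mu]_r polar_integrand (shifted_mean c) m r =
  (pi * (c * (4 / (1 + m ^+ 2)) / 2 - radial_ln (4 / (1 + m ^+ 2))) / (1 + m ^+ 2))%:E.
Proof.
move=> c3; set v := sqrt1V m; have v0 : (0 < v)%R by exact: sqrt1V_gt0.
have v2 : (v ^+ 2 = (1 + m ^+ 2)^-1)%R by exact: sqrt1V_sqr.
have pn r : ((r * v) ^+ 2 + (r * (m * v)) ^+ 2 = r ^+ 2)%R by exact: polar_norm.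
have -> : (4 / (1 + m ^+ 2) = (2 * v) ^+ 2)%R by rewrite exprMn v2; ring.
rewrite -v2.
have cf : continuous (fun r : R => r * (c - disk_mean_ln (r ^+ 2)))%R.
  move=> r; apply: cvgM; first exact: cvg_id.
  by apply: cvgB; [exact: cvg_cst|exact: continuous_disk_mean_ln_sqr].
have -> : (pi * (c * (2 * v) ^+ 2 / 2 - radial_ln ((2 * v) ^+ 2)) * v ^+ 2)%:E =
   (pi * v ^+ 2)%:E * \int[mu]_(r in `[0%R, (2 * v)%R]) (r * (c - disk_mean_ln (r ^+ 2)))%:E.
  by rewrite integral_radial ?mulr_ge0 ?(ltW v0)// -EFinM; congr EFin; ring.
rewrite -integralZl//; last exact: (continuous_integrable_itv _ _ _ cf).
rewrite [RHS]integral_mkcond; apply: eq_integral => r _.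
rewrite patchE mem_setE in_itv/= /polar_integrand -/v.
(* Membership in the shifted disk becomes [r (r - 2 v) <= 0]. *)
have shiftE : ((r * v - 1) ^+ 2 + (r * (m * v)) ^+ 2 = 1 + r * (r - 2 * v))%R.
  have -> : (r * (r - 2 * v) = r ^+ 2 - 2 * (r * v))%R by ring.
  by rewrite -(pn r); ring.
have [r0|r0|<-] := ltgtP 0%R r; last 2 first.
- rewrite shifted_mean_out ?mul0e// /shifted_disk/= shiftE; apply/negP.
  by rewrite -ltNge ltrDl nmulr_rgt0//; lra.
(* At the origin [shifted_mean_in] does not apply, but the Jacobian factor [|r|] vanishes. *)
- by rewrite normr0 !mul0r !mule0 if_same.
have [rv|rv] := leP r (2 * v)%R; last first.
  rewrite shifted_mean_out ?mul0e// /shifted_disk/= shiftE; apply/negP.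
  by rewrite -ltNge ltrDl mulr_gt0// subr_gt0.
rewrite shifted_mean_in//=.
- by rewrite pn gtr0_norm// -!EFinM; congr EFin; ring.
- rewrite /shifted_disk/= shiftE; nra.
- by rewrite pn exprn_gt0.
Qed.

(** The argument is the squared far endpoint [2 cos t] of the ray at angle [t]; [pi * cos_mean]
    turns out to be the integral of [ln |1 + x + y|] over the bidisk. *)
Definition cos_mean : R :=
  (\int[mu]_(t in `[- (pi / 2), pi / 2]) radial_ln (4 * cos t ^+ 2))%R.

Lemma integral_cos_sqr : (\int[mu]_(t in `[- (pi / 2), pi / 2]) (cos t ^+ 2) = pi / 2 :> R)%R.
Proof.
have p0 := pi_gt0 R.
rewrite /Rintegral (_ : \int[mu]_(t in _) _ = (pi / 2)%:E)//.
apply: etrans; first apply: (@FTC2_is_derive R _ (fun t =>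
  (t + sin t * cos t) / 2)%R (- (pi / 2))%R (pi / 2)%R).
- lra.
- move=> t _; apply: (@continuous_comp R R R (@cos R) (fun t => t ^+ 2)%R);
  first exact: continuous_cos.
  exact: exprn_continuous.
- move=> t _; apply: is_derive_eq; rewrite /GRing.scale/=.
  have : (sin t ^+ 2 = 1 - cos t ^+ 2)%R by exact: sin2cos2.
  by move=> e; field: e.
- by rewrite /= sinN cosN cos_pihalf; congr EFin; field.
Qed.

Lemma integral_bidisk c : (ln 3 <= c)%R ->
  \int[leb2 \x leb2]_(p in bidisk R) (c - log_abs_1xy R p)%:E =
  (pi * (pi * c - cos_mean))%:E.
Proof.
move=> c3; rewrite integral_bidisk_shifted_mean//.
have msm := measurable_shifted_mean _ c3.
have sm0 u := shifted_mean_ge0 _ u c3.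
rewrite (ge0_integral_slope_polar _ msm sm0).
under eq_integral do rewrite polar_shifted_mean//.
pose g (t : R) := (pi * (c * (4 * t) / 2 - radial_ln (4 * t)))%R.
have cg : continuous g.
  move=> t; apply: cvgM; first exact: cvg_cst.
  apply: cvgB.
    apply: cvgM; last exact: cvg_cst.
    apply: cvgM; first exact: cvg_cst.
    by apply: cvgM; [exact: cvg_cst|exact: cvg_id].
  apply: (@continuous_comp R R R (fun t => 4 * t)%R radial_ln);
    last exact: continuous_radial_ln.
  by apply: cvgM; [exact: cvg_cst|exact: cvg_id].
rewrite (@ge0_integral_tan R (fun m => g (1 + m ^+ 2)^-1%R)); first last.
- move=> m; rewrite /g mulr_ge0 ?pi_ge0// subr_ge0 radial_ln_le//.
  have h : (1 <= 1 + m ^+ 2)%R by rewrite lerDl sqr_ge0.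
  by rewrite mulr_ge0 ?invr_ge0 ?(le_trans _ h)//= ger_pMr// invf_le1// (lt_le_trans _ h).
- move=> m; apply: (@continuous_comp R R R (fun m => (1 + m ^+ 2)^-1)%R g); last exact: cg.
  exact: continuous_oneDsqrV.
have cgc : continuous (fun t => g (cos t ^+ 2)%R).
  move=> t; apply: (@continuous_comp R R R (fun t => cos t ^+ 2)%R g); last exact: cg.
  apply: (@continuous_comp R R R (@cos R) (fun t => t ^+ 2)%R); first exact: continuous_cos.
  exact: exprn_continuous.
transitivity (\int[mu]_(t in `](- (pi / 2))%R, (pi / 2)%R[) (g (cos t ^+ 2)%R)%:E).
  apply: eq_integral => t; rewrite inE/= in_itv/= => /cos_gt0_pihalf ct.
  by rewrite -cos2_tan2 ?gt_eqF// invrK.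
rewrite -(integral_itv_bndoo true false); last first.
  by apply/measurable_EFinP; apply: measurable_funTS; exact: continuous_measurable_fun.
rewrite -[LHS]fineK//; last first.
  by apply: integrable_fin_num => //; exact: (continuous_integrable_itv _ _ _ cgc).
congr EFin; rewrite -/(Rintegral _ _ _).
have cq : continuous (fun t => radial_ln (4 * cos t ^+ 2)%R).
  move=> t; apply: (@continuous_comp R R R (fun t => 4 * cos t ^+ 2)%R radial_ln);
    last exact: continuous_radial_ln.
  apply: cvgM; first exact: cvg_cst.
  apply: (@continuous_comp R R R (@cos R) (fun t => t ^+ 2)%R); first exact: continuous_cos.
  exact: exprn_continuous.
have cc : continuous (fun t : R => cos t ^+ 2)%R.
  move=> t; apply: (@continuous_comp R R R (@cos R) (fun t => t ^+ 2)%R);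
    first exact: continuous_cos.
  exact: exprn_continuous.
have ccc : continuous (fun t : R => 2 * c * cos t ^+ 2)%R.
  by move=> t; apply: cvgM; [exact: cvg_cst|exact: cc].
transitivity (\int[mu]_(t in `[- (pi / 2), pi / 2])
  (pi * (2 * c * cos t ^+ 2 - radial_ln (4 * cos t ^+ 2))))%R.
  by apply: eq_Rintegral => t _; rewrite /g; congr (_ * (_ - _))%R; field.
rewrite RintegralZl//; last first.
  apply: (continuous_integrable_itv (fun t =>
    2 * c * cos t ^+ 2 - radial_ln (4 * cos t ^+ 2))%R) => t.
  by apply: cvgB; [exact: ccc|exact: cq].
rewrite RintegralB//; [|exact: (continuous_integrable_itv _ _ _ ccc)|exact:
  (continuous_integrable_itv _ _ _ cq)].
rewrite RintegralZl//; last exact: (continuous_integrable_itv _ _ _ cc).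
by rewrite integral_cos_sqr -/cos_mean; congr (_ * (_ - _))%R; field.
Qed.

End bidisk.

(** * The integral of [ln (2 cos t)] and the character modulo 3 *)

Section L_value.
Context {R : realType}.
Local Notation mu := (@lebesgue_measure R).

Lemma cos_pithird : cos (pi / 3) = 1 / 2 :> R.
Proof.
have p0 := pi_gt0 R.
set c := cos (pi / 3); have c0 : 0 < c by apply: cos_gt0_pihalf; apply/andP; split; lra.
have : cos (pi / 3 + (pi / 3 + pi / 3)) = -1 :> R by rewrite (_ : _ + _ = pi) ?cospi//; field.
rewrite !(cosD, sinD) -/c.
have /= := sin2cos2 (pi / 3 : R); rewrite -/c; set s := sin _ => s2 h.
(* The triple-angle formula reads [4 c^3 - 3 c = -1], which has the double root [1 / 2]. *)
have : (c + 1) * (2 * c - 1) ^+ 2 = 0.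
  have -> : (c + 1) * (2 * c - 1) ^+ 2 = 4 * c ^+ 3 - 3 * c + 1 by ring.
  have -> : 4 * c ^+ 3 - 3 * c = c * (c * c - s * s) - s * (s * c + c * s).
    by ring: s2.
  by rewrite h; ring.
move/eqP; rewrite mulf_eq0 sqrf_eq0 => /orP[|] /eqP; lra.
Qed.

Lemma sin_pithird : sin (pi / 3) = Num.sqrt 3 / 2 :> R.
Proof.
have p0 := pi_gt0 R.
have s0 : 0 <= sin (pi / 3) :> R by apply: sin_ge0_pi; apply/andP; split; lra.
rewrite -[LHS](ger0_norm s0) -sqrtr_sqr sin2cos2 cos_pithird.
rewrite (_ : 1 - _ = 3 * (2^-1) ^+ 2); last by field.
by rewrite sqrtrM// sqrtr_sqr ger0_norm// invr_ge0.
Qed.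

Lemma chi_m3D3 n : chi_m3 R (n + 3) = chi_m3 R n.
Proof. by rewrite /chi_m3 modnDr. Qed.

(** Both sides have period 3 in [n], so three values decide; this is where the character enters. *)
Lemma sin_chi_m3 n : sin (2 * n%:R * (pi / 3)) = Num.sqrt 3 / 2 * chi_m3 R n.
Proof.
have cs n' : sin (2 * (n' + 3)%:R * (pi / 3)) = sin (2 * n'%:R * (pi / 3)) :> R.
  rewrite natrD (_ : 2 * _ * _ = 2 * n'%:R * (pi / 3) + pi *+ 2) ?sinD2pi//.
  by rewrite mulr2n; field.
have e2 : 2 * 1%:R * (pi / 3) = pi - pi / 3 :> R by field.
have e4 : 2 * 2%:R * (pi / 3) = pi + pi / 3 :> R by field.
elim/ltn_ind: n => -[|[|[|n]]] IH.
- by rewrite mulr0 mul0r sin0 /chi_m3/= mulr0.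
- by rewrite e2 sinB sinpi cospi sin_pithird /chi_m3/=; ring.
- by rewrite e4 sinD sinpi cospi sin_pithird /chi_m3/=; ring.
- by have := IH n; rewrite -addn3 cs chi_m3D3; apply; rewrite addn3 ltnW.
Qed.

(* [ln |1 + s e^(2it)|] minus its first [N] terms as a power series in [s]. *)
Definition ln_remainder (N : nat) (t s : R) : R :=
  ln (1 + 2 * s * cos (2 * t) + s ^+ 2) / 2 -
  \sum_(k < N) (-1) ^+ k * s ^+ k.+1 * cos (2 * k.+1%:R * t) / k.+1%:R.

(** With [z = e^(2it)], the derivative of [ln |1 + s z|] is the real part of [z / (1 + s z)].
    Removing [N] terms of the geometric series leaves [(-s)^N z^(N+1) / (1 + s z)], written here
    over [|1 + s z|^2]. *)
Lemma is_derive_ln_remainder N (t s : R) : 0 < 1 + 2 * s * cos (2 * t) + s ^+ 2 ->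
  is_derive s 1 (ln_remainder N t)
   ((-1) ^+ N * s ^+ N * (cos (2 * N.+1%:R * t) + s * cos (2 * N%:R * t)) /
    (1 + 2 * s * cos (2 * t) + s ^+ 2)).
Proof.
set P := 1 + _ + _ => P0; rewrite /ln_remainder.
elim: N => [|N IH].
  have dl : is_derive P 1 (@ln R) P^-1 by exact: is_derive1_ln.
  rewrite (_ : (fun s : R => _) = fun s => ln (1 + 2 * s * cos (2 * t) + s ^+ 2) / 2);
    last first.
    by apply/funext => x; rewrite big_ord0 subr0.
  have c0 : cos (2 * 0%:R * t) = 1 by rewrite mulr0 mul0r cos0.
  have c1 : 2 * 1%:R * t = 2 * t by rewrite mulr1.
  apply: is_derive_eq; rewrite c0 c1 /GRing.scale/= -/P.
  by field; rewrite gt_eqF.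
rewrite (_ : (fun s : R => _) = fun s => (ln (1 + 2 * s * cos (2 * t) + s ^+ 2) / 2 -
  \sum_(k < N) (-1) ^+ k * s ^+ k.+1 * cos (2 * k.+1%:R * t) / k.+1%:R) -
  (-1) ^+ N * s ^+ N.+1 * cos (2 * N.+1%:R * t) / N.+1%:R); last first.
  by apply/funext => x; rewrite big_ord_recr/= opprD addrA.
have N1 : N.+1%:R != 0 :> R by rewrite pnatr_eq0.
have dterm : is_derive s 1 (fun s => (-1) ^+ N * s ^+ N.+1 * cos (2 * N.+1%:R * t) / N.+1%:R)
    ((-1) ^+ N * s ^+ N * cos (2 * N.+1%:R * t)).
  have dX : is_derive s 1 (fun s : R => s ^+ N.+1) (N.+1%:R * s ^+ N).
    rewrite (_ : (fun s : R => _) = (@id R) ^+ N.+1); last by apply/funext => x; rewrite fctE.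
    by apply: is_derive_eq; rewrite /GRing.scale/= mulr1.
  rewrite (_ : (fun s : R => _) = (fun s => (-1) ^+ N * cos (2 * N.+1%:R * t) / N.+1%:R * s
    ^+ N.+1)); last first.
    by apply/funext => x; ring.
  by apply: is_derive_eq; rewrite /GRing.scale/=; field.
apply: (is_derive_eq (is_deriveB IH dterm)).
have -> : cos (2 * N.+2%:R * t) = 2 * cos (2 * t) * cos (2 * N.+1%:R * t) - cos (2 * N%:R * t).
  have -> : 2 * N.+2%:R * t = 2 * N.+1%:R * t + 2 * t by rewrite -(natr1 N.+1); ring.
  have -> : 2 * N%:R * t = 2 * N.+1%:R * t - 2 * t by rewrite -(natr1 N); ring.
  by rewrite cosD cosB; ring.
by rewrite !exprS /P; field; rewrite gt_eqF.
Qed.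

Lemma ler_norm_is_derive (f g f' g' : R -> R) (a b : R) : a <= b ->
  (forall s, a <= s <= b -> is_derive s 1 f (f' s)) ->
  (forall s, a <= s <= b -> is_derive s 1 g (g' s)) ->
  (forall s, a <= s <= b -> `|f' s| <= g' s) ->
  `|f b - f a| <= g b - g a.
Proof.
move=> ab df dg fg.
have sub x : x \in `]a, b[ -> a <= x <= b.
  by rewrite in_itv/= => /andP[/ltW -> /ltW ->].
have mono (h h' : R -> R) : (forall s, a <= s <= b -> is_derive s 1 h (h' s)) ->
    (forall s, a <= s <= b -> 0 <= h' s) -> h a <= h b.
  move=> dh h0; apply: (@ger0_derive1_le_cc R h a b) => //.
  - by move=> x /sub /dh [].
  - by move=> x /sub xab; have ? := dh _ xab; rewrite derive1E derive_val h0.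
  - apply: derivable_within_continuous => x; rewrite in_itv/= => /dh; by case.
  - by rewrite in_itv/= lexx ab.
  - by rewrite in_itv/= lexx ab.
have dD s : a <= s <= b -> is_derive s 1 (fun s => g s + f s) (g' s + f' s).
  by move=> sab; have ? := df _ sab; have ? := dg _ sab; exact: is_deriveD.
have dB s : a <= s <= b -> is_derive s 1 (fun s => g s - f s) (g' s - f' s).
  by move=> sab; have ? := df _ sab; have ? := dg _ sab; exact: is_deriveB.
have pD s : a <= s <= b -> 0 <= g' s + f' s.
  by move=> /fg; rewrite ler_norml => /andP[]; lra.
have pB s : a <= s <= b -> 0 <= g' s - f' s.
  by move=> /fg; rewrite ler_norml => /andP[]; lra.
have := mono _ _ dD pD; have := mono _ _ dB pB.
by rewrite ler_norml => ? ?; apply/andP; split; lra.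
Qed.

(** The denominator of the derivative is at least [1 - s + s^2], and [1 + s <= 3 (1 - s + s^2)]
    because the difference is [3 (s - 2/3)^2 + 2/3]. So the derivative is at most [3 s^N] in
    absolute value, and integrating from 0 reaches [s = 1], the edge of the disk of convergence,
    with an explicit error. *)
Lemma ln_remainder_bound N (t : R) : - (1 / 2) <= cos (2 * t) ->
  `|ln_remainder N t 1| <= 3 / N.+1%:R.
Proof.
move=> ct; have N1 : N.+1%:R != 0 :> R by rewrite pnatr_eq0.
have P0 s : 0 <= s <= 1 -> 0 < 1 + 2 * s * cos (2 * t) + s ^+ 2.
  move=> /andP[s0 s1]; have : s * - (1 / 2) <= s * cos (2 * t) by rewrite ler_wpM2l.
  have := sqr_ge0 (s - 1 / 2); nra.
have := @ler_norm_is_derive (ln_remainder N t) (fun s => 3 / N.+1%:R * s ^+ N.+1)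
  _ (fun s => 3 * s ^+ N) 0 1 ler01 (fun s s01 => is_derive_ln_remainder N t s (P0 s s01)).
have -> : ln_remainder N t 0 = 0.
  rewrite /ln_remainder mulr0 mul0r expr0n/= !addr0 ln1 mul0r big1 ?subr0// => k _.
  by rewrite expr0n/= mulr0 !mul0r.
rewrite expr0n/= expr1n mulr0 mulr1 !subr0; apply.
  move=> s _.
  have dX : is_derive s 1 (fun s : R => s ^+ N.+1) (N.+1%:R * s ^+ N).
    rewrite (_ : (fun s : R => _) = (@id R) ^+ N.+1); last by apply/funext => x; rewrite fctE.
    by apply: is_derive_eq; rewrite /GRing.scale/= mulr1.
  by apply: is_derive_eq; rewrite /GRing.scale/=; field.
move=> s s01; have P := P0 s s01; have /andP[s0 s1] := s01.
rewrite normrM [X in _ * X]ger0_norm ?invr_ge0 ?(ltW P)// ler_pdivrMr//.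
rewrite !normrM normrX normrN1 expr1n mul1r ger0_norm ?exprn_ge0//.
rewrite -[leRHS]mulrA [leRHS]mulrCA; apply: ler_wpM2l; first exact: exprn_ge0.
apply: (@le_trans _ _ (1 + s)).
  rewrite (le_trans (ler_normD _ _))// lerD ?cos_max// normrM ger0_norm// ler_piMr// cos_max//.
have : s * - (1 / 2) <= s * cos (2 * t) by rewrite ler_wpM2l.
have := sqr_ge0 (s - 2 / 3); nra.
Qed.

Lemma cos_ge_half (t : R) : - (pi / 3) <= t <= pi / 3 -> 1 / 2 <= cos t.
Proof.
move=> /andP[t1 t2]; have p0 := pi_gt0 R.
rewrite -cos_pithird -(cos_norm t) leNgt; apply/negP => h.
have : pi / 3 < `|t|.
  rewrite -ltr_cos// in_itv/= ?normr_ge0/= ?ler_norml; apply/andP; split; lra.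
rewrite ltNge ler_norml t2 andbT; lra.
Qed.

Definition cos_sum (N : nat) (t : R) : R :=
  \sum_(k < N) (-1) ^+ k * cos (2 * k.+1%:R * t) / k.+1%:R.

(** For these [t], [2 cos t = |1 + e^(2it)|] and [cos (2 t) >= - 1 / 2], so this is the remainder
    bound at [s = 1]. *)
Lemma ln_cos_bound N (t : R) : - (pi / 3) <= t <= pi / 3 ->
  `|ln (2 * cos t) - cos_sum N t| <= 3 / N.+1%:R.
Proof.
move=> /cos_ge_half ct.
have c2 : cos (2 * t) = 2 * cos t ^+ 2 - 1.
  by rewrite mulr_natl cos_mulr2n -mulr_natl.
have -> : ln (2 * cos t) - cos_sum N t = ln_remainder N t 1.
  rewrite /ln_remainder /cos_sum; congr (_ - _); last first.
    by apply: eq_bigr => k _; rewrite expr1n mulr1.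
  rewrite (_ : 1 + _ + _ = (2 * cos t) ^+ 2); last by rewrite c2; ring.
  by rewrite lnXn ?mulr_gt0//; [field|lra].
by apply: ln_remainder_bound; rewrite c2; nra.
Qed.

Lemma continuous_cosM (k : R) : continuous (fun t => cos (k * t)).
Proof.
move=> t; apply: (@continuous_comp R R R (fun t => k * t) (@cos R)); last exact: continuous_cos.
by apply: cvgM; [exact: cvg_cst|exact: cvg_id].
Qed.

Lemma continuous_cos_term (n : nat) : continuous (fun t : R =>
  (-1) ^+ n * cos (2 * n.+1%:R * t) / n.+1%:R).
Proof.
move=> t; apply: cvgM; last exact: cvg_cst.
by apply: cvgM; [exact: cvg_cst|exact: continuous_cosM].
Qed.

Lemma continuous_cos_sum N : continuous (cos_sum N).
Proof.
elim: N => [|N IH] t.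
  by rewrite (_ : cos_sum 0 = cst 0); [exact: cvg_cst|apply/funext => x;
    rewrite /cos_sum big_ord0].
rewrite (_ : cos_sum N.+1 = fun t => cos_sum N t + (-1) ^+ N * cos (2 * N.+1%:R * t) /
  N.+1%:R); last first.
  by apply/funext => x; rewrite /cos_sum big_ord_recr.
by apply: cvgD; [exact: IH|exact: continuous_cos_term].
Qed.

Lemma integral_cosM (n : nat) (a : R) : 0 <= a ->
  \int[mu]_(t in `[- a, a]) cos (2 * n.+1%:R * t) = sin (2 * n.+1%:R * a) / n.+1%:R.
Proof.
move=> a0; have n0 : n.+1%:R != 0 :> R by rewrite pnatr_eq0.
rewrite /Rintegral (_ : (\int[mu]_(t in _) _)%E = (sin (2 * n.+1%:R * a) / n.+1%:R)%:E)//.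
apply: etrans; first apply: (@FTC2_is_derive R _ (fun t =>
  sin (2 * n.+1%:R * t) / (2 * n.+1%:R)) (- a) a).
- lra.
- by move=> t _; exact: continuous_cosM.
- by move=> t _; apply: is_derive_eq; rewrite /GRing.scale/=; field.
- by rewrite /= mulrN sinN; congr EFin; field.
Qed.

(** Integrating a cosine brings the second factor [1 / (k + 1)], and its sine at the endpoint
    [pi / 3] is the character value. *)
Lemma integral_cos_sum N :
  \int[mu]_(t in `[- (pi / 3), pi / 3]) cos_sum N t =
  Num.sqrt 3 / 2 * \sum_(k < N) (-1) ^+ k * (chi_m3 R k.+1 / k.+1%:R ^+ 2).
Proof.
have p0 := pi_gt0 R.
elim: N => [|N IH].
  rewrite big_ord0 mulr0; under eq_Rintegral do rewrite /cos_sum big_ord0.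
  by rewrite Rintegral_cst// mul0r.
under eq_Rintegral do rewrite /cos_sum big_ord_recr/= -/(cos_sum N _).
rewrite RintegralD//; last 2 first.
- exact: (continuous_integrable_itv _ _ _ (continuous_cos_sum N)).
- exact: (continuous_integrable_itv _ _ _ (continuous_cos_term N)).
rewrite IH big_ord_recr/= mulrDr; congr (_ + _).
transitivity (\int[mu]_(t in `[- (pi / 3), pi / 3])
  ((-1) ^+ N / N.+1%:R * cos (2 * N.+1%:R * t))).
  by apply: eq_Rintegral => t _; ring.
rewrite RintegralZl//; last exact: (continuous_integrable_itv _ _ _ (continuous_cosM _)).
rewrite integral_cosM; last by lra.
have N1 : N.+1%:R != 0 :> R by rewrite pnatr_eq0.
by rewrite sin_chi_m3; field; rewrite nat1r.
Qed.

Definition ln_cos_integral : R := \int[mu]_(t in `[- (pi / 3), pi / 3]) ln (2 * cos t).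

Lemma ln_cos_integrable : mu.-integrable `[- (pi / 3), pi / 3] (EFin \o (fun t =>
  ln (2 * cos t))).
Proof.
apply: continuous_compact_integrable; first exact: segment_compact.
apply: continuous_in_subspaceT => t; rewrite inE/= in_itv/= => /cos_ge_half ct.
apply: (@continuous_comp R R R (fun t => 2 * cos t) (@ln R)).
  by apply: cvgM; [exact: cvg_cst|exact: continuous_cos].
by apply: continuous_ln; rewrite mulr_gt0//; lra.
Qed.

Lemma ln_cos_integral_bound N :
  `|ln_cos_integral - Num.sqrt 3 / 2 * \sum_(k < N)
    (-1) ^+ k * (chi_m3 R k.+1 / k.+1%:R ^+ 2)| <=
  2 * pi / N.+1%:R.
Proof.
have p0 := pi_gt0 R.
have ic := continuous_integrable_itv _ (- (pi / 3)) (pi / 3) (continuous_cos_sum N).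
rewrite -integral_cos_sum /ln_cos_integral -RintegralB//; last exact: ln_cos_integrable.
apply: (le_trans (le_normr_Rintegral _ _)) => //.
  exact: (integrableB _ ln_cos_integrable ic).
(* The uniform error [3 / (N + 1)] times the length [2 pi / 3] of the interval. *)
rewrite (_ : 2 * pi / N.+1%:R = \int[mu]_(t in `[- (pi / 3), pi / 3]) (3 / N.+1%:R));
  last first.
  rewrite Rintegral_cst//= lebesgue_measure_itv/= lte_fin ifT; last by lra.
  have N1 : N.+1%:R != 0 :> R by rewrite pnatr_eq0.
  by rewrite /=; field; rewrite nat1r.
apply: le_Rintegral => //.
- by apply: integrable_norm; exact: (integrableB _ ln_cos_integrable ic).
- by apply: (continuous_integrable_itv (fun=> 3 / N.+1%:R)) => t; exact: cvg_cst.
- by move=> t; rewrite /= in_itv/=; exact: ln_cos_bound.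
Qed.

End L_value.

(** * Closed forms of the angular integrals *)

Section closed_form.
Context {R : realType}.
Local Notation mu := (@lebesgue_measure R).

Definition L_partial (N : nat) : R := \sum_(1 <= n < N) (chi_m3 R n / n%:R ^+ 2).

(** Telescoping comparison with [1 / (k (k - 1))] from [k = 2] on; the term at [k = 0] is 0 since
    the inverse of 0 is 0. *)
Lemma sum_inv_sqr_le n : \sum_(0 <= k < n.+2) (k%:R ^+ 2)^-1 <= 2 - n.+1%:R^-1 :> R.
Proof.
elim: n => [|n IH].
  by rewrite big_nat_recr//= big_nat1 expr0n/= invr0 expr1n invr1; lra.
rewrite big_nat_recr//=; apply: (le_trans (lerD IH (lexx _))).
suff h : (n.+2%:R ^+ 2)^-1 <= n.+1%:R^-1 - n.+2%:R^-1 :> R.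
  by apply: (le_trans (lerD (lexx _) h)); rewrite addrA subrK.
have n0 : 0 <= n%:R :> R by [].
rewrite -(natr1 n.+1) -(natr1 n); set x : R := n%:R in n0 *.
have -> : (x + 1)^-1 - (x + 1 + 1)^-1 = ((x + 1) * (x + 1 + 1))^-1.
  by field; apply/andP; split; lra.
rewrite lef_pV2 ?posrE; nra.
Qed.

(** Needed because [L_chi_m3_2] is a [limn], which is a genuine limit only once convergence is
    known. It converges absolutely. *)
Lemma is_cvg_L_partial : cvgn L_partial.
Proof.
pose u (n : nat) : R := chi_m3 R n / n%:R ^+ 2.
have -> : L_partial = series u.
  apply/funext => -[|N]; first by rewrite /L_partial /series/= !big_geq.
  by rewrite /L_partial /series/= [RHS]big_nat_recl//= {1}/u expr0n/= invr0 mulr0 add0r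
    big_add1.
apply: normed_cvg.
apply: (@series_le_cvg _ _ (fun k => (k%:R ^+ 2)^-1)) => [n|n|n|].
- exact: normr_ge0.
- by rewrite invr_ge0 sqr_ge0.
- rewrite /= /u normrM [X in _ * X]ger0_norm ?invr_ge0 ?sqr_ge0// ler_piMl ?invr_ge0 ?sqr_ge0//.
  by rewrite /chi_m3; case: ifP => _; [|case: ifP => _]; rewrite ?normr1 ?normrN1 ?normr0.
apply: nondecreasing_is_cvgn.
  apply/nondecreasing_seqP => n; rewrite /series/= big_nat_recr//= lerDl invr_ge0 sqr_ge0//.
exists 2 => _ [n _ <-].
rewrite /series/=; apply: (@le_trans _ _ (\sum_(0 <= k < n.+2) (k%:R ^+ 2)^-1)).
  by rewrite [leRHS]big_nat_recr//= [X in _ <= X + _]big_nat_recr//= -addrA lerDl addr_ge0//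
    invr_ge0 sqr_ge0.
by rewrite (le_trans (sum_inv_sqr_le n))// gerBl invr_ge0.
Qed.

Lemma cvg_L_partial : L_partial @ \oo --> L_chi_m3_2 R.
Proof. exact: is_cvg_L_partial. Qed.

Lemma chi_m3_double m : chi_m3 R (2 * m)%N = - chi_m3 R m.
Proof.
rewrite /chi_m3 -modnMmr; have := ltn_pmod m (isT : (0 < 3)%N).
by case: (m %% 3)%N => [|[|[|]]]//=; rewrite ?oppr0 ?opprK.
Qed.

(** The alternating sum is the full sum minus twice its even-indexed terms. The term at [2 m] is
    [- 1 / 4] of the term at [m], as the character is [-1] at 2, so the correction is [+ 1 / 2].
    Stopping at [2 M] makes the even indices exactly [m <= M]. *)
Lemma alternating_L_partial M :
  \sum_(k < (2 * M)%N) (-1) ^+ k * (chi_m3 R k.+1 / k.+1%:R ^+ 2) =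
  L_partial (2 * M)%N.+1 + L_partial M.+1 / 2.
Proof.
elim: M => [|M IH].
  by rewrite muln0 big_ord0 /L_partial !big_geq// mul0r addr0.
have -> : (2 * M.+1 = (2 * M)%N.+2)%N by rewrite mulnS.
rewrite !big_ord_recr/= IH /L_partial.
rewrite !(big_nat_recr _.+2)//= !(big_nat_recr (2 * M)%N.+1)//= !(big_nat_recr M.+1)//=.
have e1 : (-1) ^+ (2 * M)%N = 1 :> R by rewrite exprM sqrrN !expr1n.
have e2 : (-1) ^+ (2 * M)%N.+1 = -1 :> R by rewrite exprS e1 mulr1.
rewrite e2 e1 mul1r.
have -> : (2 * M)%N.+2 = (2 * M.+1)%N by rewrite mulnS.
rewrite chi_m3_double natrM.
have M1 : M.+1%:R != 0 :> R by rewrite pnatr_eq0.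
set a := chi_m3 R (2 * M)%N.+1 / _; set m : R := M.+1%:R in M1 *.
by field.
Qed.

Lemma ln_cos_integralE : @ln_cos_integral R = 3 * Num.sqrt 3 / 4 * L_chi_m3_2 R.
Proof.
(* The subsequence of even lengths is enough: it tends to [sqrt 3 / 2] times [3 / 2 L], and also to
   the integral by the explicit error bound. *)
pose A M := Num.sqrt 3 / 2 * (L_partial (2 * M)%N.+1 + L_partial M.+1 / 2).
have l1 : A @ \oo --> Num.sqrt 3 / 2 * (L_chi_m3_2 R + L_chi_m3_2 R / 2).
  apply: cvgM; first exact: cvg_cst.
  apply: cvgD.
    apply: (@cvg_comp _ _ _ (fun M => (2 * M)%N.+1) L_partial); last exact: cvg_L_partial.
    apply/cvgnyPge => n; near=> M.
    apply: (@leq_trans M); last by rewrite leqW// leq_pmull.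
    by near: M; exact: nbhs_infty_ge.
  apply: cvgM; last exact: cvg_cst.
  by move: cvg_L_partial; rewrite -(cvg_shiftS).
have l2 : A @ \oo --> @ln_cos_integral R.
  apply/cvgrPdist_le => e e0.
  have : (fun M => 2 * pi * harmonic M : R) @ \oo --> (2 * pi * 0 : R).
    by apply: cvgM; [exact: cvg_cst|exact: cvg_harmonic].
  move=> /cvgrPdist_le/(_ _ e0); apply: filterS => M.
  rewrite mulr0 sub0r normrN => h.
  have := @ln_cos_integral_bound R (2 * M)%N; rewrite alternating_L_partial -/(A M).
  move=> /le_trans; apply; apply: le_trans h; apply: le_trans (ler_norm _).
  rewrite /harmonic/= ler_wpM2l ?mulr_ge0 ?pi_ge0// lef_pV2 ?posrE// ler_nat ltnS.
  by rewrite leq_pmull.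
by rewrite (cvg_unique _ l2 l1)//; field.
Unshelve. all: by end_near. Qed.

Lemma cos_meanE : @cos_mean R = pi / 6 - 11 * Num.sqrt 3 / 16 + ln_cos_integral.
Proof.
have p0 := pi_gt0 R.
pose q (t : R) := radial_ln (4 * cos t ^+ 2).
have cq : continuous q.
  move=> t; apply: (@continuous_comp R R R (fun t => 4 * cos t ^+ 2)%R radial_ln);
    last exact: continuous_radial_ln.
  apply: cvgM; first exact: cvg_cst.
  apply: (@continuous_comp R R R (@cos R) (fun t => t ^+ 2)%R); first exact: continuous_cos.
  exact: exprn_continuous.
have iq a b := continuous_integrable_itv q a b cq.
rewrite /cos_mean (@Rintegral_itv_split _ _ _ (- (pi / 3))); [|lra|lra|exact: iq].
rewrite (@Rintegral_itv_split _ _ (- (pi / 3)) (pi / 3)); [|lra|lra|exact: iq].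
(* A primitive for [|t| >= pi / 3], where [4 cos^2 t <= 1] and [radial_ln] reduces to
   [2 cos^4 t - cos^2 t]. *)
pose F (t : R) := t / 4 + sin t * cos t / 4 + sin t * cos t ^+ 3 / 2.
have dF (t : R) : is_derive t 1 F (2 * cos t ^+ 4 - cos t ^+ 2).
  apply: is_derive_eq; rewrite /GRing.scale/=.
  have : sin t ^+ 2 = 1 - cos t ^+ 2 by exact: sin2cos2.
  by move=> e; field: e.
have outer a b : a <= b -> (forall t, a <= t <= b -> cos t ^+ 2 <= 4^-1) ->
    \int[mu]_(t in `[a, b]) radial_ln (4 * cos t ^+ 2) = F b - F a.
  move=> ab cs.
  rewrite /Rintegral (_ : (\int[mu]_(t in _) _)%E = (F b - F a)%:E)//.
  transitivity (\int[mu]_(t in `[a, b]) (2 * cos t ^+ 4 - cos t ^+ 2)%:E)%E.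
    apply: eq_integral => t; rewrite inE/= in_itv/= => /cs ct; congr EFin.
    by rewrite /radial_ln min_l ?max_r ?ln1; [field|lra|lra].
  apply: FTC2_is_derive => // t _; apply: cvgB.
    apply: cvgM; first exact: cvg_cst.
    apply: (@continuous_comp R R R (@cos R) (fun t => t ^+ 4)); first exact: continuous_cos.
    exact: exprn_continuous.
  apply: (@continuous_comp R R R (@cos R) (fun t => t ^+ 2)); first exact: continuous_cos.
  exact: exprn_continuous.
have cos_le_half (t : R) : pi / 3 <= t <= pi / 2 -> cos t ^+ 2 <= 4^-1.
  move=> /andP[t1 t2].
  have c0 : 0 <= cos t by apply: cos_ge0_pihalf; apply/andP; split; lra.
  have c1 : cos t <= 1 / 2.
    rewrite -cos_pithird leNgt ltr_cos ?in_itv/=; [lra|by apply/andP; split;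
      lra|by apply/andP; split; lra].
  nra.
have abL : - (pi / 2) <= - (pi / 3) :> R by lra.
have abR : pi / 3 <= pi / 2 :> R by lra.
have cL (t : R) : - (pi / 2) <= t <= - (pi / 3) -> cos t ^+ 2 <= 4^-1.
  move=> /andP[t1 t2]; rewrite -cosN; apply: cos_le_half; apply/andP; split; lra.
rewrite (outer _ _ abL cL) (outer _ _ abR cos_le_half).
have -> : \int[mu]_(t in `[- (pi / 3), pi / 3]) radial_ln (4 * cos t ^+ 2) =
    pi / 12 - Num.sqrt 3 / 2 + ln_cos_integral.
  (* For [|t| <= pi / 3], [radial_ln] is [1/8 - cos^2 t + 2 cos^2 t ln (2 cos t)]. Subtracting
     [ln (2 cos t)] leaves the factor [2 cos^2 t - 1], the derivative of [sin t cos t], before the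
     logarithm; integration by parts then gives an elementary primitive. Its logarithm vanishes at
     both endpoints, where [2 cos t = 1]. *)
  pose F2 (t : R) := t / 8 - sin t * cos t + sin t * cos t * ln (2 * cos t).
  pose f2 (t : R) := q t - ln (2 * cos t).
  have : \int[mu]_(t in `[- (pi / 3), pi / 3]) f2 t = F2 (pi / 3) - F2 (- (pi / 3)).
    rewrite /Rintegral (_ : (\int[mu]_(t in _) _)%E = (F2 (pi / 3) - F2 (- (pi / 3)))%:E)//.
    apply: FTC2_is_derive; first lra.
    - move=> t /cos_ge_half ct; apply: cvgB; first exact: cq.
      apply: (@continuous_comp R R R (fun t => 2 * cos t) (@ln R)).
        by apply: cvgM; [exact: cvg_cst|exact: continuous_cos].
      by apply: continuous_ln; lra.
    - move=> t /cos_ge_half ct.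
      have c0 : 0 < 2 * cos t by lra.
      have dl : is_derive (2 * cos t) 1 (@ln R) (2 * cos t)^-1 by exact: is_derive1_ln.
      apply: is_derive_eq; rewrite /GRing.scale/=.
      rewrite /f2 /q /radial_ln (_ : 4 * cos t ^+ 2 = (2 * cos t) ^+ 2); last by ring.
      have c1 : 1 <= (2 * cos t) ^+ 2 by nra.
      rewrite min_r// max_l// lnXn// mulr2n.
      have : sin t ^+ 2 = 1 - cos t ^+ 2 by exact: sin2cos2.
      move=> e; field: e; lra.
  rewrite RintegralB//; last exact: ln_cos_integrable.
  rewrite -/(ln_cos_integral) /F2 cosN sinN cos_pithird sin_pithird.
  rewrite (_ : 2 * (1 / 2) = 1) ?ln1; last by field.
  by move=> /eqP; rewrite subr_eq => /eqP ->; field.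
rewrite /F !cosN !sinN !cos_pihalf !cos_pithird !sin_pithird.
by field.
Qed.

End closed_form.

(** * Removing the shift by a constant, and the final value *)

Section conclusion.
Context {R : realType}.
Local Open Scope ereal_scope.

Local Notation m := (@leb2 R \x @leb2 R).

Lemma measurable_bidisk : measurable (bidisk R).
Proof. by apply: measurableX; exact: measurable_diskC. Qed.

Lemma measurable_log_abs_1xy : measurable_fun setT (log_abs_1xy R).
Proof.
apply: measurable_fun_ln_norm.
  apply: measurable_funD; last exact: measurableT_comp.
  by apply: measurable_funD => //; exact: measurableT_comp.
by apply: measurable_funD; exact: measurableT_comp.
Qed.

Lemma log_abs_1xy_le c p : (ln 3 <= c)%R -> bidisk R p -> (log_abs_1xy R p <= c)%R.
Proof.
move=> c3 [x1 y1]; apply: ln_norm_add_le => //.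
have := @shifted_disk_le4 R (p.1.1 + 1, p.1.2)%R; rewrite /shifted_disk/= addrK addrC.
by rewrite (addrC p.1.1) addrC => /(_ x1).
Qed.

Lemma measure_bidisk : m (bidisk R) = (pi ^+ 2)%:E.
Proof.
have mB := measurable_bidisk; have mlog := measurable_log_abs_1xy.
have c3 : (ln 3 <= ln 3 + 1 :> R)%R by rewrite lerDl.
have E1 := @integral_bidisk R _ c3; have E0 := @integral_bidisk R _ (lexx (ln 3)).
have e : \int[m]_(p in bidisk R) (ln 3 + 1 - log_abs_1xy R p)%:E =
    \int[m]_(p in bidisk R) (ln 3 - log_abs_1xy R p)%:E + m (bidisk R).
  rewrite -[X in _ + X]mul1e -integral_cst// -ge0_integralD//.
  - by apply: eq_integral => p _; rewrite -EFinD; congr EFin; ring.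
  - by move=> p Bp; rewrite lee_fin subr_ge0 log_abs_1xy_le.
  - by apply/measurable_EFinP/measurable_funTS/measurable_funB.
have -> : m (bidisk R) = (pi * (pi * (ln 3 + 1) - cos_mean))%:E - (pi * (pi * ln 3 -
  cos_mean))%:E.
  by rewrite -E1 -E0 e addeAC E0 subee// add0e.
by rewrite -EFinB; congr EFin; ring.
Qed.

Lemma integrable_bidisk c : (ln 3 <= c)%R ->
  m.-integrable (bidisk R) (fun p => (c - log_abs_1xy R p)%:E).
Proof.
move=> c3; apply/integrableP; split.
  apply/measurable_EFinP/measurable_funTS/measurable_funB => //.
  exact: measurable_log_abs_1xy.
have -> : \int[m]_(p in bidisk R) `|(c - log_abs_1xy R p)%:E| =
    \int[m]_(p in bidisk R) (c - log_abs_1xy R p)%:E.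
  apply: eq_integral => p; rewrite inE => Bp.
  by rewrite gee0_abs// lee_fin subr_ge0 log_abs_1xy_le.
by rewrite integral_bidisk// ltry.
Qed.

(** The measure of the bidisk enters twice: its finiteness makes the constant [ln 3] integrable, and
    its value [pi^2] makes the two contributions of [ln 3] cancel. *)
Lemma integral_log_abs_1xy :
  m.-integrable (bidisk R) (fun p => (log_abs_1xy R p)%:E) /\
  \int[m]_(p in bidisk R) (log_abs_1xy R p)%:E = (pi * cos_mean)%:E.
Proof.
have mB := measurable_bidisk.
have ic : m.-integrable (bidisk R) (fun=> (ln 3)%:E).
  apply/integrableP; split; first exact: measurable_cst.
  rewrite integral_cst// [X in _ * X](_ : _ = (pi ^+ 2)%:E); last exact: measure_bidisk.
  by rewrite -EFinM ltry.
have ig := integrable_bidisk _ (lexx _).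
have e : (fun p => (log_abs_1xy R p)%:E) =
    (fun p => (ln 3)%:E - (ln 3 - log_abs_1xy R p)%:E).
  by apply/funext => p; rewrite -EFinB; congr EFin; ring.
rewrite e; split; first exact: integrableB.
rewrite integralB// integral_bidisk// integral_cst//.
rewrite [X in _ * X - _](_ : _ = (pi ^+ 2)%:E); last exact: measure_bidisk.
by rewrite -EFinM -EFinB; congr EFin; ring.
Qed.

End conclusion.

(* m_D(1 + x + y) = 1/pi^2 * int_{D^2} log|1+x+y| dA(x) dA(y)
                  = 3 sqrt3/(4 pi) L(chi_{-3},2) + 1/6 - 11 sqrt3/(16 pi). *)
Theorem theorem1p1 (R : realType) :
  (lebC2 R).-integrable (bidisk R) (fun p => (log_abs_1xy R p)%:E) /\
  ((pi ^- 2)%:E * \int[lebC2 R]_(p in bidisk R) (log_abs_1xy R p)%:E)%E =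
  (3 * Num.sqrt 3 / (4 * pi) * L_chi_m3_2 R + 6^-1
     - 11 * Num.sqrt 3 / (16 * pi))%:E.
Proof.
have [ilog elog] := @integral_log_abs_1xy R.
(* [lebC2 R] and the square of [leb2] agree by conversion. *)
split; first exact: ilog.
apply: (etrans (congr1 (fun x => (pi ^- 2)%:E * x)%E elog)).
rewrite -EFinM cos_meanE ln_cos_integralE; congr EFin.
have p0 : pi != 0 :> R by apply/lt0r_neq0/pi_gt0.
by move: (pi : R) p0 => x x0; field.
Qed.
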